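(* Let $\Pi=(P,\mathcal{L})$ and $\Pi'=(P',\mathcal{L}')$ be $n$-dimensional projective spaces and let $k$ be an integer with $0<k<n-1$. Let $f$ be a mapping of $\mathcal{G}_{k}(\Pi)$ to $\mathcal{G}_{k}(\Pi')$ which sends every base subset of $\mathcal{G}_{k}(\Pi)$ to a base subset of $\mathcal{G}_{k}(\Pi')$. Then: (1) if $n\ne 2k+1$, there is a strong embedding $g$ of $\Pi$ to $\Pi'$ with $f=G_{k}(g)$; (2) if $n=2k+1$, there is a strong embedding $g$ of $\Pi$ to $\Pi'$ or of $\Pi$ to the dual space $\Pi'^{*}$ with $f=G_{k}(g)$ (in the dual case, $G_k(g)$ is regarded as a map to $\mathcal{G}_k(\Pi')$ via the identification $\mathcal{G}_{k}(\Pi'^{*})=\mathcal{G}_{n-k-1}(\Pi')=\mathcal{G}_k(\Pi')$).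
   Context: A linear space $\Pi=(P,\mathcal{L})$ is a set $P$ of points with a family $\mathcal{L}$ of proper subsets (lines) such that each line has at least two points and any two distinct points $p,q$ lie on exactly one line $pq$. Points are collinear if some line contains them. A subspace is a set $S\subset P$ with $pq\subset S$ for all distinct $p,q\in S$; $\overline{X}$ denotes the smallest subspace containing $X$. A set $X$ is independent if $\overline{X}$ is not spanned by a proper subset of $X$; a base of a subspace $S$ is an independent set spanning $S$. A subspace is $m$-dimensional if $m+1$ is the smallest number of points spanning it (the empty set is $(-1)$-dimensional). A projective space is a linear space in which every $2$-dimensional subspace is a projective plane: any two of its lines meet and every line has at least three points. $\mathcal{G}_k(\Pi)$ is the set of $k$-dimensional subspaces. If $B$ is a base of $\Pi$, the base subset of $\mathcal{G}_k(\Pi)$ associated with $B$ is the set of all $k$-dimensional subspaces spanned by points of $B$. A strong embedding of $\Pi$ to $\Pi'$ is an injection $g:P\to P'$ sending collinear triples to collinear triples, non-collinear triples to non-collinear triples, and independent sets to independent sets; then $\dim\overline{g(S)}=\dim S$ for every subspace $S$, and $G_k(g):\mathcal{G}_k(\Pi)\to\mathcal{G}_k(\Pi')$ is $S\mapsto\overline{g(S)}$. The dual $\Pi'^{*}$ of an $n$-dimensional projective space $\Pi'$ has as points the $(n-1)$-dimensional subspaces of $\Pi'$, and as lines the sets of all $(n-1)$-dimensional subspaces containing a fixed $(n-2)$-dimensional subspace; it is an $n$-dimensional projective space whose $k$-dimensional subspaces are the sets of all $(n-1)$-dimensional subspaces of $\Pi'$ containing a fixed $(n-k-1)$-dimensional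 subspace, and $\mathcal{G}_k(\Pi'^{*})$ is identified with $\mathcal{G}_{n-k-1}(\Pi')$ in this way. *)

(* Defs.v *)
From Stdlib Require Import List.
Import ListNotations.

Section LinearSpaces.
Variable P : Type.
Variable L : (P -> Prop) -> Prop.

Definition subset (X Y : P -> Prop) : Prop := forall x, X x -> Y x.

Definition is_linear_space : Prop :=
  (forall l, L l -> exists p, ~ l p) /\
  (forall l, L l -> exists p q, p <> q /\ l p /\ l q) /\
  (forall p q, p <> q -> exists! l, L l /\ l p /\ l q).

Definition collinear (X : P -> Prop) : Prop := exists l, L l /\ subset X l.

Definition subspace (S : P -> Prop) : Prop :=
  forall p q l, p <> q -> S p -> S q -> L l -> l p -> l q -> subset l S.

Definition span (X : P -> Prop) : P -> Prop :=
  fun x => forall S, subspace S -> subset X S -> S x.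

Definition independent (X : P -> Prop) : Prop :=
  forall Y, subset Y X -> (exists x, X x /\ ~ Y x) -> span Y <> span X.

Definition base (B : P -> Prop) : Prop :=
  independent B /\ span B = (fun _ => True).

Definition list_set (xs : list P) : P -> Prop := fun x => In x xs.

(* [sdim S c] : S is a subspace and [c] is the smallest number of points
   spanning it, i.e. S is (c-1)-dimensional. *)
Definition sdim (S : P -> Prop) (c : nat) : Prop :=
  subspace S /\
  (exists xs, length xs = c /\ span (list_set xs) = S) /\
  (forall xs, length xs < c -> span (list_set xs) <> S).

Definition dimk (S : P -> Prop) (k : nat) : Prop := sdim S (Datatypes.S k).

Definition projective_space (n : nat) : Prop :=
  is_linear_space /\
  sdim (fun _ => True) (Datatypes.S n) /\
  (forall S, sdim S 3 ->
     (forall l1 l2, L l1 -> L l2 -> subset l1 S -> subset l2 S ->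
        exists p, l1 p /\ l2 p) /\
     (forall l, L l -> subset l S ->
        exists a b c, l a /\ l b /\ l c /\ a <> b /\ a <> c /\ b <> c)).

Definition base_subset (B : P -> Prop) (k : nat) : (P -> Prop) -> Prop :=
  fun S => dimk S k /\ exists X, subset X B /\ span X = S.

End LinearSpaces.

Arguments subset {P}.
Arguments list_set {P}.
Arguments collinear {P}.
Arguments independent {P}.
Arguments base {P}.

Definition image {A B : Type} (g : A -> B) (X : A -> Prop) : B -> Prop :=
  fun y => exists x, X x /\ g x = y.

Definition strong_embedding {P Q : Type} (L : (P -> Prop) -> Prop)
  (M : (Q -> Prop) -> Prop) (g : P -> Q) : Prop :=
  (forall x y, g x = g y -> x = y) /\
  (forall p q r, collinear L (fun x => x = p \/ x = q \/ x = r) ->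
                 collinear M (fun y => y = g p \/ y = g q \/ y = g r)) /\
  (forall p q r, ~ collinear L (fun x => x = p \/ x = q \/ x = r) ->
                 ~ collinear M (fun y => y = g p \/ y = g q \/ y = g r)) /\
  (forall X, independent L X -> independent M (image g X)).

Definition sends_base_subsets {P Q : Type} (L : (P -> Prop) -> Prop)
  (M : (Q -> Prop) -> Prop) (k : nat) (f : (P -> Prop) -> (Q -> Prop)) : Prop :=
  forall B, base L B -> exists B', base M B' /\
    forall T, (exists S, base_subset P L B k S /\ f S = T) <-> base_subset Q M B' k T.

Definition hyperplane {Q : Type} (M : (Q -> Prop) -> Prop) (n : nat) : Type :=
  { H : Q -> Prop | sdim Q M H n }.

Definition dual_lines {Q : Type} (M : (Q -> Prop) -> Prop) (n : nat)
  : (hyperplane M n -> Prop) -> Prop :=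
  fun l => exists U, sdim Q M U (n - 1) /\
    l = (fun H : hyperplane M n => subset U (proj1_sig H)).

(* Main.v *)
(* Two k-subspaces always lie in a common base subset, so f is injective, and it suffices to understand
   f on the base subset of a base (a "frame" b), where it is a permutation phi of the (k+1)-subsets of
   the n+1 indices. The sets that are not separated by an ordered pair (i, j) (they contain j if they
   contain i) form a maximal family lying in a second base subset; hence phi permutes the families
   C_ij = {A | i in A, j notin A}. Recording which of these are disjoint shows that phi is induced by a
   permutation of the indices, possibly followed by complementation when n = 2k+1.
   The same alternative holds for all bases, because stars (sets of all k-subspaces through a
   (k-1)-subspace) go into stars in the first case and into sets of subspaces with no common point in
   the second. In the first case f descends from k to k-1 by intersecting the images of a star, and
   finally yields a map of points; in the second case the first one applies to the dual of the target.
   Below, ranks of subspaces are projective dimensions plus one. *)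
From mathcomp Require all_boot zify perm boolp.
From Stdlib Require List Lia Classical ClassicalEpsilon FunctionalExtensionality PropExtensionality.
From Pilot Require Import Defs.

Module LinearGeometry.
Import mathcomp.boot.ssreflect.
Import List Lia Classical ClassicalEpsilon FunctionalExtensionality PropExtensionality.
Import ListNotations.

(** * Rank and modularity in projective spaces *)

Lemma set_ext {P : Type} (X Y : P -> Prop) : (forall x, X x <-> Y x) -> X = Y.
Proof.
move=> h; apply: functional_extensionality => x; exact: propositional_extensionality.
Qed.

Section Geometry.
Variables (P : Type) (L : (P -> Prop) -> Prop) (n : nat).
Hypothesis prj : projective_space P L n.

Definition spl (xs : list P) : P -> Prop := span P L (list_set xs).

Definition join (S T : P -> Prop) : P -> Prop := span P L (fun x => S x \/ T x).

Definition meet (S T : P -> Prop) : P -> Prop := fun x => S x /\ T x.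

Lemma span_subspace X : subspace P L (span P L X).
Proof.
move=> p q l pq Xp Xq Ll lp lq x lx S HS XS.
exact: (HS p q l pq (Xp S HS XS) (Xq S HS XS) Ll lp lq).
Qed.

Lemma span_incl X x : X x -> span P L X x.
Proof. by move=> Xx S _; apply. Qed.

Lemma span_min X S : subspace P L S -> subset X S -> subset (span P L X) S.
Proof. by move=> HS XS x; apply. Qed.

Lemma span_mono X Y : subset X Y -> subset (span P L X) (span P L Y).
Proof.
move=> XY; apply: span_min; first exact: span_subspace.
by move=> x Xx; apply: span_incl; apply: XY.
Qed.

Lemma spl_in xs x : In x xs -> spl xs x.
Proof. exact: span_incl. Qed.

Lemma spl_subspace xs : subspace P L (spl xs).
Proof. exact: span_subspace. Qed.

Lemma spl_min xs S : subspace P L S -> (forall x, In x xs -> S x) -> subset (spl xs) S.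
Proof. exact: span_min. Qed.

Lemma spl_mono xs ys : incl xs ys -> subset (spl xs) (spl ys).
Proof. exact: span_mono. Qed.

Lemma spl_sub xs ys : (forall x, In x xs -> spl ys x) -> subset (spl xs) (spl ys).
Proof. by apply: spl_min; apply: spl_subspace. Qed.

Lemma meet_subspace S T : subspace P L S -> subspace P L T -> subspace P L (meet S T).
Proof.
move=> HS HT p q l pq [Sp Tp] [Sq Tq] Ll lp lq x lx.
by split; [exact: (HS p q l) | exact: (HT p q l)].
Qed.

Lemma line_ex p q : p <> q -> exists l, L l /\ l p /\ l q.
Proof.
case: prj => [[_ [_ H]] _] pq; case: (H p q pq) => l [h _]; by exists l.
Qed.

Lemma line_eq p q l l' : p <> q -> L l -> l p -> l q -> L l' -> l' p -> l' q -> l = l'.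
Proof.
case: prj => [[_ [_ H]] _] pq Ll lp lq Ll' lp' lq'; case: (H p q pq) => l0 [_ u].
by rewrite -(u l) // -(u l').
Qed.

Lemma line_subspace l : L l -> subspace P L l.
Proof.
move=> Ll p q l' pq lp lq Ll' lp' lq' x.
by rewrite (line_eq p q l' l).
Qed.

Lemma spl_line p q l : p <> q -> L l -> l p -> l q -> spl [p; q] = l.
Proof.
move=> pq Ll lp lq; apply: set_ext => x; split.
- by apply: spl_min; [exact: line_subspace | move=> y /= [<-|[<-|[]]]].
- by move=> lx; apply: (spl_subspace [p; q] p q l) => //; apply: spl_in; rewrite /=; auto.
Qed.

Lemma spl_nil x : ~ spl [] x.
Proof. by move=> H; apply: (H (fun _ => False)) => [p q l _ []|y []]. Qed.

Lemma spl_single a x : spl [a] x -> x = a.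
Proof.
move=> H; apply: (H (fun y => y = a)) => [p q l pq pa qa|y [->|[]]] //.
by case: pq; rewrite pa qa.
Qed.

Lemma spl_two a b p q : spl [a; b] p -> spl [a; b] q -> p <> q ->
  spl [a; b] = spl [p; q].
Proof.
move=> Hp Hq pq; case: (classic (a = b)) => [ab|ab].
  have E x : spl [a; b] x -> x = a.
    by move=> Hx; apply: spl_single; apply: spl_mono Hx => y; rewrite ab /=; tauto.
  by case: pq; rewrite (E _ Hp) (E _ Hq).
case: (line_ex a b ab) => l [Ll [la lb]].
move: Hp Hq; rewrite (spl_line a b l) // => lp lq.
by rewrite (spl_line p q l).
Qed.

Lemma spl_sym a b : spl [a; b] = spl [b; a].
Proof.
by apply: set_ext => x; split; apply: spl_mono => y /=; tauto.
Qed.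

Lemma ln_exchange a b z : spl [a; b] z -> z <> b -> spl [z; b] a.
Proof.
move=> H zb; rewrite -(spl_two a b z b) //; apply: spl_in; rewrite /=; auto.
Qed.

Lemma ln_sub S a b : subspace P L S -> S a -> S b -> subset (spl [a; b]) S.
Proof. by move=> HS Sa Sb; apply: spl_min => // y /= [<-|[<-|[]]]. Qed.

Lemma plane_sdim p a b : p <> a -> ~ spl [p; a] b -> sdim P L (spl [p; a; b]) 3.
Proof.
move=> pa Hb; split; first exact: spl_subspace.
split; first by exists [p; a; b].
have Ip : spl [p; a; b] p by apply: spl_in; rewrite /=; auto.
have Ia : spl [p; a; b] a by apply: spl_in; rewrite /=; auto.
have Ib : spl [p; a; b] b by apply: spl_in; rewrite /=; auto.
move=> [|x [|y [|z xs]]] /= H; try lia; rewrite -/(spl _) => E.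
- by move: Ip; rewrite -E; apply: spl_nil.
- by move: Ip Ia pa; rewrite -E => /spl_single -> /spl_single ->.
- by move: Ip Ia Ib; rewrite -E => Ip Ia; rewrite (spl_two x y p a).
Qed.

(** The three-point axiom speaks only of lines inside planes, so a point [r] off the line, available
    because lines are proper subsets, first supplies a plane. *)
Lemma third_point p q : p <> q -> exists c, spl [p; q] c /\ c <> p /\ c <> q.
Proof.
move=> pq; case: (line_ex p q pq) => l [Ll [lp lq]].
have [[Hpr _] [_ Hpl]] := prj.
case: (Hpr l Ll) => r nr.
have Hr : ~ spl [p; q] r by rewrite (spl_line p q l).
have [_ H3] := Hpl _ (plane_sdim p q r pq Hr).
have lE := spl_line p q l pq Ll lp lq.
case: (H3 l Ll) => [|a [b [c [la [lb [lc [ab [ac bc]]]]]]]].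
  by rewrite -lE; apply: spl_mono => y /=; tauto.
rewrite lE.
case: (classic (a = p \/ a = q)) => [Ha|]; last by exists a; tauto.
case: (classic (b = p \/ b = q)) => [Hb|]; last by exists b; tauto.
by exists c; split => //; split => E; subst c; case: Ha => E; subst a; case: Hb => E; subst b.
Qed.

Definition cone (S : P -> Prop) (p : P) : P -> Prop :=
  fun z => z = p \/ exists s, S s /\ spl [p; s] z.

(** For [z1] on [p s1] and [z2] on [p s2], the line [p w] meets the line [s1 s2] in the plane of
    [p], [s1], [s2], and the meeting point lies in [S]. This is where the axiom on coplanar lines
    enters. *)
Lemma cone_subspace S p : subspace P L S -> subspace P L (cone S p).
Proof.
move=> HS z1 z2 l z12 C1 C2 Ll l1 l2 w lw.
have lE : spl [z1; z2] = l by apply: spl_line.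
have key s : spl [p; s] z1 -> spl [p; s] z2 -> S s -> cone S p w.
  move=> h1 h2 Ss; right; exists s; split => //.
  by rewrite (spl_two p s z1 z2) // lE.
have Hp s : spl [p; s] p by apply: spl_in; rewrite /=; auto.
case: C1 => [E1|[s1 [S1 H1]]]; case: C2 => [E2|[s2 [S2 H2]]].
- by subst.
- by subst z1; apply: (key s2).
- by subst z2; apply: (key s1).
case: (classic (S p)) => [Sp|nSp].
  right; exists w; split; last by apply: spl_in; rewrite /=; auto.
  by apply: (HS z1 z2 l) => //; [move: H1 | move: H2]; apply: ln_sub.
have ps1 : p <> s1 by move=> E; subst.
have ps2 : p <> s2 by move=> E; subst.
case: (classic (spl [p; s1] s2)) => [C|nC].
  apply: (key s1) => //; move: H2; apply: ln_sub => //; exact: spl_subspace.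
case: (classic (w = p)) => [->|wp]; first by left.
have pl := plane_sdim p s1 s2 ps1 nC.
have [_ [_ Hpl]] := prj.
have [meets _] := Hpl _ pl.
have s12 : s1 <> s2 by move=> E; apply: nC; rewrite -E; apply: spl_in; rewrite /=; auto.
case: (line_ex p w) => [|l1' [Ll1 [lp1 lw1]]]; first by move=> E; subst.
case: (line_ex s1 s2 s12) => l2' [Ll2 [ls1 ls2]].
have E1 : spl [p; w] = l1' by apply: spl_line => //; move=> E; subst.
have E2 : spl [s1; s2] = l2' by apply: spl_line.
have HE := spl_subspace [p; s1; s2].
have Ep : spl [p; s1; s2] p by apply: spl_in; rewrite /=; auto.
have Es1 : spl [p; s1; s2] s1 by apply: spl_in; rewrite /=; auto.
have Es2 : spl [p; s1; s2] s2 by apply: spl_in; rewrite /=; auto.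
case: (meets l1' l2' Ll1 Ll2) => [| |x [x1 x2]].
- rewrite -E1; apply: ln_sub => //.
  apply: (HE z1 z2 l) => //; [move: H1 | move: H2]; by apply: ln_sub.
- by rewrite -E2; apply: ln_sub.
have Sx : S x by move: x2; rewrite -E2; apply: ln_sub.
right; exists x; split => //.
rewrite (spl_line p x l1') //; by move=> E; subst.
Qed.

Lemma span_cone X x z : span P L (fun y => y = x \/ X y) z <-> cone (span P L X) x z.
Proof.
split.
- apply: span_min; first by apply: cone_subspace; apply: span_subspace.
  move=> y [->|Xy]; first by left.
  by right; exists y; split; [apply: span_incl | apply: spl_in; rewrite /=; auto].
- case=> [->|[s [Hs]]]; first by apply: span_incl; left.
  apply: ln_sub; [exact: span_subspace | by apply: span_incl; left|].
  by move: Hs; apply: span_mono => y; right.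
Qed.

Lemma spl_cone xs x z : spl (x :: xs) z <-> cone (spl xs) x z.
Proof.
rewrite -span_cone; split; apply: span_mono => y /=; rewrite /list_set /=; intuition.
Qed.

(** By the cone description, [y] lies on a line through [x] and some [s] in [spl xs]; since
    [y <> s], this is also the line [y s]. *)
Lemma spl_exchange xs x y : spl (x :: xs) y -> ~ spl xs y -> spl (y :: xs) x.
Proof.
rewrite spl_cone => -[->|[s [Hs H]]] ny; first by apply: spl_in; rewrite /=; auto.
have ys : y <> s by move=> E; subst.
move: (ln_exchange x s y H ys); apply: ln_sub; first exact: spl_subspace.
- by apply: spl_in; left.
- by move: Hs; apply: spl_mono => a; right.
Qed.

Lemma join_subspace S T : subspace P L (join S T).
Proof. exact: span_subspace. Qed.

Lemma join_l S T : subset S (join S T).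
Proof. by move=> x Sx; apply: span_incl; left. Qed.

Lemma join_r S T : subset T (join S T).
Proof. by move=> x Sx; apply: span_incl; right. Qed.

Lemma join_min S T U : subspace P L U -> subset S U -> subset T U -> subset (join S T) U.
Proof. by move=> HU SU TU; apply: span_min => // x [/SU|/TU]. Qed.

(** The union of the lines joining [S] to [T] is closed under lines: a point in the span of [t2],
    [t1], [s1], [s2] is brought by [spl_cone] into the span of some [s] in [S] with [t1] and [t2],
    and then onto a line [s t]. An empty [S] or [T] leaves no joining lines and is split off
    first. *)
Lemma join_lines S T z : subspace P L S -> subspace P L T -> join S T z ->
  S z \/ T z \/ exists s t, S s /\ T t /\ spl [s; t] z.
Proof.
move=> HS HT.
case: (classic (exists s, S s)) => [[s0 Ss0]|nS]; last first.
  move=> H; right; left; move: H; apply: join_min => // x Sx; case: nS; by exists x.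
case: (classic (exists s, T s)) => [[t0 Tt0]|nT]; last first.
  move=> H; left; move: H; apply: join_min => // x Sx; case: nT; by exists x.
move=> H; right; right; move: z H.
change (subset (join S T) (fun z => exists s t, S s /\ T t /\ spl [s; t] z)).
have I1 a b : spl [a; b] a by apply: spl_in; rewrite /=; auto.
have I2 a b : spl [a; b] b by apply: spl_in; rewrite /=; auto.
apply: join_min; last first.
- by move=> t Tt; exists s0, t.
- by move=> s Ss; exists s, t0.
move=> z1 z2 l z12 [s1 [t1 [Ss1 [Tt1 H1]]]] [s2 [t2 [Ss2 [Tt2 H2]]]] Ll l1 l2 w lw.
have: spl [t2; t1; s1; s2] w.
  apply: (spl_subspace _ z1 z2 l) => //; [move: H1|move: H2]; by apply: spl_mono => y /=; tauto.
rewrite spl_cone => -[->|[v [Hv Hw]]]; first by exists s1, t2.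
move: Hv; rewrite spl_cone => -[E|[s [Hs Hv]]].
  subst v; exists s1, w; split => //; split => //.
  by move: Hw; apply: ln_sub.
have Ss : S s by move: Hs; apply: ln_sub.
have: spl [s; t1; t2] w.
  move: Hw; apply: ln_sub; [exact: spl_subspace | by apply: spl_in; rewrite /=; auto |].
  by move: Hv; apply: spl_mono => y /=; tauto.
rewrite spl_cone => -[->|[t [Ht Hw']]]; first by exists s, t1.
by exists s, t; split => //; split => //; move: Ht; apply: ln_sub.
Qed.

(** * Independent lists, exchange and rank *)

Fixpoint indl (xs : list P) : Prop :=
  match xs with [] => True | x :: ys => ~ spl ys x /\ indl ys end.

Lemma indl_catr xs ys : indl (xs ++ ys) -> indl ys.
Proof. by elim: xs => [|x xs IH] //= [_ /IH]. Qed.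

Lemma indl_drop xs ys zs : indl (xs ++ ys ++ zs) -> indl (xs ++ zs).
Proof.
elim: xs => [|x xs IH] /=; first exact: indl_catr.
case=> H /IH h; split => // Hx; apply: H; move: Hx.
apply: spl_mono => y; rewrite !in_app_iff; tauto.
Qed.

(** When entries of [zs] are deleted from the front, [y] is the one whose removal expels [x] from
    the span; it can therefore be exchanged for [x]. *)
Lemma exchange_split xs zs x : spl (zs ++ xs) x -> ~ spl xs x ->
  exists u y v, zs = u ++ y :: v /\ spl (y :: v ++ xs) x /\ ~ spl (v ++ xs) x.
Proof.
elim: zs => [|z zs IH] //= H nx.
case: (classic (spl (zs ++ xs) x)) => [h|h]; last by exists [], z, zs.
case: (IH h nx) => u [y [v [E [h1 h2]]]].
by exists (z :: u), y, v; rewrite E.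
Qed.

(** Induction on [xs]: each new [x] enters and the [y] found by [exchange_split] leaves, so the
    length is kept and the span does not shrink. *)
Lemma steinitz xs ys : indl xs -> (forall x, In x xs -> spl ys x) ->
  exists zs, length zs + length xs = length ys /\ subset (spl ys) (spl (zs ++ xs)).
Proof.
elim: xs => [|x xs IH] /=.
  by move=> _ _; exists ys; rewrite app_nil_r; split; [lia | move=> z].
move=> [nx ind] H; case: (IH ind) => [y yx|zs [Hl Hs]]; first by apply: H; right.
have Hx : spl (zs ++ xs) x by apply: Hs; apply: H; left.
case: (exchange_split xs zs x Hx nx) => u [y [v [E [h1 h2]]]].
have hy := spl_exchange _ _ _ h1 h2.
exists (u ++ v); split.
  by rewrite -Hl E !length_app /=; lia.
move=> z /Hs; apply: spl_sub => t; rewrite E !in_app_iff /= => -[[h|[h|h]]|h];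
  try by apply: spl_in; rewrite !in_app_iff /=; tauto.
by subst t; move: hy; apply: spl_mono => a /=; rewrite !in_app_iff /=; tauto.
Qed.

Lemma indl_length xs ys : indl xs -> (forall x, In x xs -> spl ys x) -> length xs <= length ys.
Proof. by move=> i h; case: (steinitz xs ys i h) => zs [E _]; lia. Qed.

Lemma spl_top : exists ts, length ts = S n /\ spl ts = (fun _ => True).
Proof. by case: prj => _ [[_ [H _]] _]. Qed.

Lemma indl_bound xs : indl xs -> length xs <= S n.
Proof.
by case: spl_top => ts [<- E] h; apply: indl_length => // x _; rewrite E.
Qed.

Lemma indl_extend (X : P -> Prop) xs : indl xs ->
  exists ys, (forall y, In y ys -> X y) /\ indl (ys ++ xs) /\ subset X (spl (ys ++ xs)).
Proof.
have [d] : exists d, d = S n - length xs by eexists.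
elim: d xs => [|d IH] xs E ind.
  exists []; split => //; split => // x Xx; apply: NNPP => h.
  by have /indl_bound /= : indl (x :: xs) by []; lia.
case: (classic (subset X (spl xs))) => [h|h]; first by exists [].
case: (not_all_ex_not _ _ h) => x {h} Hx.
have Xx : X x by tauto.
have nx : ~ spl xs x by tauto.
case: (IH (x :: xs)) => [/=||ys [h1 [h2 h3]]]; [lia | by split |].
exists (ys ++ [x]); rewrite -!app_assoc; split => // y; rewrite in_app_iff /= => -[/h1|[<-|]] //.
Qed.

Lemma subspace_basis S : subspace P L S -> exists xs, indl xs /\ spl xs = S.
Proof.
move=> HS; case: (indl_extend S []) => // ys; rewrite app_nil_r => -[h1 [h2 h3]].
exists ys; split => //; apply: set_ext => x; split; [exact: spl_min | exact: h3].
Qed.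

Lemma sdim_indl xs : indl xs -> sdim P L (spl xs) (length xs).
Proof.
move=> ind; split; first exact: spl_subspace.
split; first by exists xs.
move=> ys Hl E; have := indl_length xs ys ind.
rewrite /spl E; have h := spl_in xs; move/(_ h); lia.
Qed.

Lemma sdim_uniq S r r' : sdim P L S r -> sdim P L S r' -> r = r'.
Proof.
move=> [_ [[xs [Ex Sx]] Hx]] [_ [[ys [Ey Sy]] Hy]].
case: (PeanoNat.Nat.lt_trichotomy r r') => [h|[//|h]].
- by case: (Hy xs); rewrite ?Ex.
- by case: (Hx ys); rewrite ?Ey.
Qed.

(** The number of points in a base, hence the projective dimension plus one. The value is meaningful
    only on subspaces, where [rk_sdim] applies. *)
Definition rk (S : P -> Prop) : nat := epsilon (inhabits 0) (sdim P L S).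

Lemma rk_eq S r : sdim P L S r -> rk S = r.
Proof.
move=> h; apply: (sdim_uniq S) => //; apply: epsilon_spec; by exists r.
Qed.

Lemma rk_indl xs : indl xs -> rk (spl xs) = length xs.
Proof. by move=> /sdim_indl /rk_eq. Qed.

Lemma rk_sdim S : subspace P L S -> sdim P L S (rk S).
Proof.
by move=> /subspace_basis [xs [h <-]]; rewrite rk_indl //; apply: sdim_indl.
Qed.

Lemma rk_spl_le xs : rk (spl xs) <= length xs.
Proof.
have [_ [_ h]] := rk_sdim _ (spl_subspace xs).
by case: (Compare_dec.le_lt_dec (rk (spl xs)) (length xs)) => // /h [].
Qed.

Lemma rk_top : rk (fun _ => True) = S n.
Proof. by case: prj => _ [/rk_eq]. Qed.

Lemma rk_le S T : subspace P L S -> subspace P L T -> subset S T -> rk S <= rk T.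
Proof.
move=> /subspace_basis [xs [hx <-]] /subspace_basis [ys [hy <-]] h.
rewrite !rk_indl //; apply: indl_length => // x xx; apply: h; exact: spl_in.
Qed.

Lemma rk_max S : subspace P L S -> rk S <= Datatypes.S n.
Proof. by move=> h; rewrite -rk_top; apply: rk_le. Qed.

Lemma rk_sub_eq S T : subspace P L S -> subspace P L T -> subset S T -> rk T <= rk S -> S = T.
Proof.
move=> /subspace_basis [xs [hx <-]] HT h.
case: (indl_extend T xs hx) => ys [h1 [h2 h3]].
have <- : spl (ys ++ xs) = T.
  apply: set_ext => x; split; last exact: h3.
  apply: spl_min => // y; rewrite in_app_iff => -[/h1//|hy]; apply: h; exact: spl_in.
by rewrite !rk_indl // length_app; case: ys {h1 h2 h3} => //= y ys; lia.
Qed.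

(** A basis [zs] of the intersection is extended to [S] by [ss] and to [T] by [ts]; the formula is a
    count once the three lists together are independent. *)
Lemma rk_modular S T : subspace P L S -> subspace P L T ->
  rk (meet S T) + rk (join S T) = rk S + rk T.
Proof.
move=> HS HT; have HI := meet_subspace S T HS HT.
case: (subspace_basis _ HI) => zs [iz Ez].
case: (indl_extend S zs iz) => ss [hs [iss Hss]].
case: (indl_extend T zs iz) => ts [ht [it Hts]].
have ES : spl (ss ++ zs) = S.
  apply: set_ext => x; split; last exact: Hss.
  apply: spl_min => // y; rewrite in_app_iff => -[/hs//|/spl_in]; by rewrite Ez => -[].
have ET : spl (ts ++ zs) = T.
  apply: set_ext => x; split; last exact: Hts.
  apply: spl_min => // y; rewrite in_app_iff => -[/ht//|/spl_in]; by rewrite Ez => -[].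
have ind : indl (ts ++ ss ++ zs).
  have : forall t, In t ts -> T t by [].
  elim: ts it {ht Hts ET} => [|t ts IH] //= [nt it] H.
  split; last by apply: IH => // t' h; apply: H; right.
  set V := spl (ts ++ zs) in nt *.
  have HV : subspace P L V by apply: spl_subspace.
  have VT : subset V T.
    apply: spl_min => // y; rewrite in_app_iff => -[h|/spl_in]; first by apply: H; right.
    by rewrite Ez => -[].
  have Tt : T t by apply: H; left.
  have IV x : S x -> T x -> V x.
    move=> Sx Tx; have : spl zs x by rewrite Ez.
    by apply: spl_mono => a; rewrite in_app_iff; tauto.
  (* If [t] is in neither [V] nor [S], it lies on a line joining [v] in [V] to [s] in [S]. As [t]
     and [v] are in [T], so is [s]; hence [s] is in the intersection and [t] already in [V]. *)
  move=> Ht; have : join V S t.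
    move: Ht; apply: spl_min; first exact: join_subspace.
    move=> y; rewrite in_app_iff => -[h|h].
      by apply: join_l; apply: spl_in; rewrite in_app_iff; tauto.
    by apply: join_r; rewrite -ES; apply: spl_in.
  case/(join_lines _ _ _ HV HS) => [//|[St|[v [s [Vv [Ss H1]]]]]].
    by apply: nt; apply: IV.
  have tv : t <> v by move=> E; subst.
  have : spl [t; v] s by apply: ln_exchange => //; rewrite spl_sym.
  move/(ln_sub T _ _ HT Tt (VT _ Vv)) => Ts.
  by apply: nt; move: H1; apply: ln_sub => //; apply: IV.
have -> : join S T = spl (ts ++ ss ++ zs).
  apply: set_ext => x; split.
  - apply: join_min; first exact: spl_subspace.
      by rewrite -ES; apply: spl_mono => a; rewrite !in_app_iff; tauto.
    by rewrite -ET; apply: spl_mono => a; rewrite !in_app_iff; tauto.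
  - apply: spl_min; first exact: join_subspace.
    move=> y; rewrite in_app_iff => -[/ht h|h]; first exact: join_r.
    by apply: join_l; rewrite -ES; apply: spl_in.
rewrite -Ez -ES -ET !rk_indl // !length_app; lia.
Qed.

(** A basis [zs] of the intersection is extended to [S], then by points [us] of [U], then to the
    whole space. That [us] and [zs] span [U] follows from modularity by comparing ranks. *)
Lemma common_basis S U : subspace P L S -> subspace P L U ->
  exists ws, indl ws /\ length ws = Datatypes.S n /\ spl ws = (fun _ => True) /\
    exists xs ys, incl xs ws /\ incl ys ws /\ spl xs = S /\ spl ys = U.
Proof.
move=> HS HU; have HI := meet_subspace S U HS HU.
case: (subspace_basis _ HI) => zs [iz Ez].
case: (indl_extend S zs iz) => ss [hs [iss Hss]].
case: (indl_extend U _ iss) => us [hu [iu Hus]].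
case: (indl_extend (fun _ => True) _ iu) => ts [_ [it Hts]].
exists (ts ++ us ++ ss ++ zs).
have top : spl (ts ++ us ++ ss ++ zs) = (fun _ => True).
  by apply: set_ext => x; split => // _; apply: Hts.
have ES : spl (ss ++ zs) = S.
  apply: set_ext => x; split; last exact: Hss.
  apply: spl_min => // y; rewrite in_app_iff => -[/hs//|/spl_in]; by rewrite Ez => -[].
split => //; split; first by rewrite -rk_indl // top rk_top.
split => //; exists (ss ++ zs), (us ++ zs).
split; first by move=> a; rewrite !in_app_iff; tauto.
split; first by move=> a; rewrite !in_app_iff; tauto.
split => //; apply: rk_sub_eq => //; first exact: spl_subspace.
  apply: spl_min => // y; rewrite in_app_iff => -[/hu//|/spl_in]; by rewrite Ez => -[].
have M := rk_modular S U HS HU.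
have EJ : join S U = spl (us ++ ss ++ zs).
  apply: set_ext => x; split.
  - apply: join_min; first exact: spl_subspace.
      by rewrite -ES; apply: spl_mono => a; rewrite !in_app_iff; tauto.
    by move=> u Uu; apply: Hus.
  - apply: spl_min; first exact: join_subspace.
    move=> y; rewrite in_app_iff => -[/hu h|h]; first exact: join_r.
    by apply: join_l; rewrite -ES; apply: spl_in.
rewrite (rk_indl (us ++ zs)); last exact: indl_drop iu.
move: M; rewrite EJ -Ez -{1}ES !rk_indl // !length_app; lia.
Qed.

(** A proper subset omits some [x], and the remaining list is too short to span. Together with
    [independent_indl], this matches the recursive [indl], suited to induction, with independence of
    sets. *)
Lemma indl_independent xs : indl xs -> independent L (list_set xs).
Proof.
move=> ind Y YX [x [Hx nY]] E; case: (in_split _ _ Hx) => u [v Ex].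
have: subset (spl xs) (spl (u ++ v)).
  rewrite /spl -E; apply: span_mono => y Yy; have := YX y Yy.
  rewrite /list_set Ex !in_app_iff /= => -[|[e|]]; try tauto.
  by subst y.
move=> h; have := indl_length xs (u ++ v) ind (fun x hx => h x (spl_in xs x hx)).
by rewrite Ex !length_app /=; lia.
Qed.

Lemma independent_indl X : independent L X -> exists xs, indl xs /\ X = list_set xs.
Proof.
move=> ind; case: (indl_extend X []) => // xs; rewrite app_nil_r => -[h1 [h2 h3]].
exists xs; split => //; apply: set_ext => x; split; last exact: h1.
move=> Xx; apply: NNPP => h; apply: (ind (list_set xs) h1); first by exists x.
apply: set_ext => y; split; first exact: span_mono.
by apply: span_min => //; apply: span_subspace.
Qed.

Lemma collinear_indl p q r : 1 <= n ->
  collinear L (fun x => x = p \/ x = q \/ x = r) <-> ~ indl [p; q; r].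
Proof.
move=> n1; split.
  move=> [l [Ll H]] /= [h1 [h2 [h3 _]]].
  have qr : q <> r by move=> E; subst; apply: h2; apply: spl_in; left.
  by apply: h1; rewrite (spl_line q r l) //; apply: H; tauto.
move=> nind.
(* Coinciding points must also lie on a common line; [1 <= n] provides a second point for this. *)
have two a b : exists l, L l /\ l a /\ l b.
  case: (classic (a = b)) => [<-|]; last exact: line_ex.
  have [c ca] : exists c, c <> a.
    apply: NNPP => h; have : rk (spl [a]) <= 1 by apply: (rk_spl_le [a]).
    have -> : spl [a] = (fun _ => True).
      apply: set_ext => x; split => // _; apply: spl_in; left.
      apply: NNPP => e; apply: h; exists x; by apply: not_eq_sym.
    by rewrite rk_top; lia.
  by case: (line_ex c a ca) => l [Ll [_ la]]; exists l.
case: (classic (q = r)) => [E|qr].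
  by subst r; case: (two p q) => l [Ll [lp lq]]; exists l; split => // x [->|[->|->]].
case: (line_ex q r qr) => l [Ll [lq lr]]; exists l; split => // x [->|[->|->]] //.
apply: NNPP => lp; apply: nind; split; first by rewrite (spl_line q r l).
split; first by move/spl_single.
by split => //; apply: spl_nil.
Qed.

End Geometry.

Arguments rk {P} L S.
Arguments spl {P} L xs.
Arguments join {P} L S T.
Arguments meet {P} S T.
Arguments indl {P} L xs.

(** * The dual space *)

Section Dual.
Variables (Q : Type) (M : (Q -> Prop) -> Prop) (n : nat).
Hypothesis prj : projective_space Q M n.
Hypothesis n2 : 2 <= n.

Let hyp := hyperplane M n.

Definition up (U : Q -> Prop) : hyp -> Prop := fun H => subset U (proj1_sig H).

Lemma hyp_eq (H1 H2 : hyp) : proj1_sig H1 = proj1_sig H2 -> H1 = H2.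
Proof.
case: H1 H2 => [H1 p1] [H2 p2] /= E; subst H2; congr (exist _ _ _); exact: proof_irrelevance.
Qed.

Lemma hyp_subspace (H : hyp) : subspace Q M (proj1_sig H).
Proof. by case: H => H []. Qed.

Lemma rk_hyp (H : hyp) : rk M (proj1_sig H) = n.
Proof. by case: H => H h; apply: rk_eq. Qed.

(** A basis of [W] together with [p] is completed to a basis of the space; dropping [p] from it
    leaves a hyperplane. *)
Lemma hyp_exists W p : subspace Q M W -> ~ W p -> exists H : hyp, up W H /\ ~ proj1_sig H p.
Proof.
move=> HW nWp; case: (subspace_basis _ _ _ prj _ HW) => xs [ind E]; subst W.
have ind' : indl M (p :: xs) by split.
case: (indl_extend _ _ _ prj (fun _ => True) _ ind') => ys [_ [iy top]].
have ind2 : indl M (ys ++ xs) by apply: (indl_drop _ _ ys [p] xs).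
have E : rk M (spl M (ys ++ p :: xs)) = Datatypes.S n.
  rewrite -(rk_top _ _ _ prj); congr (rk M _); apply: set_ext => x; split => // _; exact: top.
move: E; rewrite (rk_indl _ _ _ prj) // length_app /= => E.
have hl : length (ys ++ xs) = n by rewrite length_app; lia.
have sd : sdim Q M (spl M (ys ++ xs)) n by rewrite -hl; apply: sdim_indl prj _ ind2.
exists (exist (fun H => sdim Q M H n) _ sd); split.
  by apply: spl_mono => y h; apply: in_or_app; right.
move=> /= Hp; have : length (ys ++ p :: xs) <= length (ys ++ xs).
  apply: (indl_length _ _ _ prj) => // y; rewrite in_app_iff /= => h.
  case: h => [h|[<-//|h]]; apply: spl_in; rewrite in_app_iff; tauto.
by rewrite !length_app /=; lia.
Qed.

Lemma up_sub W W' : subspace Q M W -> subset (up W) (up W') -> subset W' W.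
Proof.
move=> HW h x W'x; apply: NNPP => nW; case: (hyp_exists W x HW nW) => H [WH nH].
by apply: nH; apply: (h H WH).
Qed.

Lemma up_inj W W' : subspace Q M W -> subspace Q M W' -> up W = up W' -> W = W'.
Proof.
move=> HW HW' E; apply: set_ext => x; split; [apply: up_sub | apply: up_sub] => // H; by rewrite E.
Qed.

Lemma rk_meet_hyp (H : hyp) I : subspace Q M I -> ~ subset I (proj1_sig H) ->
  rk M (meet (proj1_sig H) I) + 1 = rk M I.
Proof.
move=> HI nI; have HH := hyp_subspace H.
have := rk_modular _ _ _ prj _ _ HH HI; rewrite rk_hyp.
have HJ := join_subspace _ M (proj1_sig H) I.
have := rk_max _ _ _ prj _ HJ.
case: (PeanoNat.Nat.eq_dec (rk M (join M (proj1_sig H) I)) (Datatypes.S n)) => [|ne]; first by lia.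
move=> h _; case: nI.
rewrite (rk_sub_eq _ _ _ prj _ _ HH HJ); [exact: join_r | exact: join_l | rewrite rk_hyp; lia].
Qed.

Lemma rk_meet_hyps (H1 H2 : hyp) : H1 <> H2 -> rk M (meet (proj1_sig H1) (proj1_sig H2)) = n - 1.
Proof.
move=> ne; have := rk_meet_hyp H1 (proj1_sig H2) (hyp_subspace H2).
rewrite rk_hyp => h; suff : ~ subset (proj1_sig H2) (proj1_sig H1) by move/h; lia.
move=> s; apply: ne; apply: hyp_eq; symmetry.
apply: (rk_sub_eq _ _ _ prj _ _ (hyp_subspace H2) (hyp_subspace H1) s); rewrite !rk_hyp; lia.
Qed.

Lemma line_meet (H1 H2 : hyp) U : H1 <> H2 -> sdim Q M U (n - 1) -> up U H1 -> up U H2 ->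
  U = meet (proj1_sig H1) (proj1_sig H2).
Proof.
move=> ne sU U1 U2; apply: (rk_sub_eq _ _ _ prj).
- by case: sU.
- by apply: meet_subspace; apply: hyp_subspace.
- by move=> x Ux; split; [apply: U1 | apply: U2].
- by rewrite rk_meet_hyps // (rk_eq _ _ _ _ sU); lia.
Qed.

Lemma meet_sdim (H1 H2 : hyp) : H1 <> H2 ->
  sdim Q M (meet (proj1_sig H1) (proj1_sig H2)) (n - 1).
Proof.
move=> ne; rewrite -(rk_meet_hyps H1 H2 ne); apply: (rk_sdim _ _ _ prj).
apply: meet_subspace; exact: hyp_subspace.
Qed.

Lemma up_subspace W : subspace hyp (dual_lines M n) (up W).
Proof.
move=> H1 H2 l ne W1 W2 [U [sU ->]] U1 U2 H UH x Wx; apply: UH.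
by rewrite (line_meet H1 H2 U ne sU U1 U2); split; [apply: W1 | apply: W2].
Qed.

(** Two points [p], [q] complete a basis of [U] to one of the space, and [c] is a third point of the
    line [p q]; the hyperplanes are the spans of [U] with each of [p], [q], [c]. *)
Lemma hyp_three U : sdim Q M U (n - 1) -> exists H1 H2 H3 : hyp,
  up U H1 /\ up U H2 /\ up U H3 /\ H1 <> H2 /\ H1 <> H3 /\ H2 <> H3.
Proof.
move=> sU; have [HU _] := sU; have rU := rk_eq _ _ _ _ sU.
case: (subspace_basis _ _ _ prj _ HU) => xs [ind E]; subst U.
case: (indl_extend _ _ _ prj (fun _ => True) _ ind) => ys [_ [iy top]].
have : rk M (spl M (ys ++ xs)) = Datatypes.S n.
  rewrite -(rk_top _ _ _ prj); congr (rk M _); apply: set_ext => x; split => // _; exact: top.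
move: rU; rewrite !(rk_indl _ _ _ prj) // length_app => lx ly.
case: ys iy ly {top} => [|p [|q [|r ys]]] //=; try lia.
move=> [np [nq _]] _.
have npx : ~ spl M xs p.
  by move=> h; apply: np; move: h; apply: spl_mono => y; right.
have nq' : ~ spl M (p :: xs) q by move=> h; apply: np; apply: (spl_exchange _ _ _ prj).
have pq : p <> q by move=> E; apply: np; rewrite E; apply: spl_in; left.
case: (third_point _ _ _ prj p q pq) => c [Hc [cp cq]].
have ncq : ~ spl M (q :: xs) c.
  move=> h; apply: np; have := ln_exchange _ _ _ prj _ _ _ Hc cq.
  by apply: ln_sub => //; [exact: spl_subspace | apply: spl_in; left].
have ncp : ~ spl M (p :: xs) c.
  move=> h; apply: nq'; have := Hc; rewrite spl_sym => Hc'.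
  have := ln_exchange _ _ _ prj _ _ _ Hc' cp.
  by apply: ln_sub => //; [exact: spl_subspace | apply: spl_in; left].
have ncx : ~ spl M xs c by move=> h; apply: ncp; move: h; apply: spl_mono => y; right.
have mk x : ~ spl M xs x -> exists H : hyp, proj1_sig H = spl M (x :: xs).
  move=> nx; have ix : indl M (x :: xs) by split.
  have sd : sdim Q M (spl M (x :: xs)) n.
    by have := sdim_indl _ _ _ prj _ ix; rewrite /= lx; have -> : Datatypes.S (n - 1) = n by lia.
  by exists (exist (fun H => sdim Q M H n) _ sd).
case: (mk p npx) => H1 E1; case: (mk q nq) => H2 E2; case: (mk c ncx) => H3 E3.
have inU x H : proj1_sig H = spl M (x :: xs) -> up (spl M xs) H.
  by move=> E; rewrite /up E; apply: spl_mono => y; right.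
have inx x : spl M (x :: xs) x by apply: spl_in; left.
exists H1, H2, H3; split; first exact: inU E1.
split; first exact: inU E2.
split; first exact: inU E3.
split; first by move=> E; apply: np; rewrite -E2 -E E1.
split; first by move=> E; apply: ncp; rewrite -E1 E E3.
by move=> E; apply: ncq; rewrite -E2 E E3.
Qed.

Lemma dual_linear : is_linear_space hyp (dual_lines M n).
Proof.
split.
  move=> l [U [sU ->]].
  have rU := rk_eq _ _ _ _ sU.
  case: (classic (exists p, U p)) => [[p Up]|nU].
    case: (hyp_exists (spl M []) p (spl_subspace _ _ _)) => [|H [_ nH]]; first exact: spl_nil.
    by exists H => h; apply: nH; apply: h.
  move: rU; have -> : U = spl M [].
    by apply: set_ext => x; split => [Ux|h]; [case: nU; exists x | case: (spl_nil _ _ _ h)].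
  by rewrite (rk_indl _ _ _ prj) //=; lia.
split.
  move=> l [U [sU ->]]; case: (hyp_three U sU) => H1 [H2 [_ [U1 [U2 [_ [ne _]]]]]].
  by exists H1, H2.
move=> H1 H2 ne; exists (up (meet (proj1_sig H1) (proj1_sig H2))); split.
  split; first by eexists; split; first exact: meet_sdim ne.
  by split => x [].
move=> l [[U [sU ->]] [U1 U2]].
by rewrite -(line_meet H1 H2 U ne sU U1 U2).
Qed.

Definition inter (Hs : list hyp) : Q -> Prop := fun x => forall H, In H Hs -> proj1_sig H x.

Lemma inter_subspace Hs : subspace Q M (inter Hs).
Proof.
by move=> p q l pq hp hq Ll lp lq x lx H inH; apply: (hyp_subspace H p q l) => //; [apply: hp|apply: hq].
Qed.

Lemma inter_cons H Hs : inter (H :: Hs) = meet (proj1_sig H) (inter Hs).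
Proof.
apply: set_ext => x; split.
  by move=> h; split; [apply: h; left | move=> H' h'; apply: h; right].
by move=> [h1 h2] H' [<-|/h2].
Qed.

Lemma rk_inter Hs : n + 1 <= rk M (inter Hs) + length Hs.
Proof.
elim: Hs => [|H Hs IH].
  have -> : inter [] = (fun _ => True) by apply: set_ext => x; split => // _ H [].
  by rewrite (rk_top _ _ _ prj) /=; lia.
rewrite inter_cons /=; case: (classic (subset (inter Hs) (proj1_sig H))) => s.
  have -> : meet (proj1_sig H) (inter Hs) = inter Hs.
    by apply: set_ext => x; split => [[]//|h]; split => //; apply: s.
  by lia.
have := rk_meet_hyp H (inter Hs) (inter_subspace Hs) s; lia.
Qed.

(** For the induction step, let [I] be the intersection of [Hs], and let [H] contain the
    intersection of [H0] and [I]. With [W] the intersection of [H] and [H0], the join of [W] and [I]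
    is a hyperplane [H'] through [I], and [H], [H'], [H0] lie on the dual line given by [W]. *)
Lemma dual_spl Hs : spl (dual_lines M n) Hs = up (inter Hs).
Proof.
apply: set_ext => H; split.
  by apply: spl_min; [exact: up_subspace | move=> H' h x; apply].
elim: Hs H => [|H0 Hs IH] H.
  move=> h; have := rk_max _ _ _ prj _ (hyp_subspace H).
  have E : proj1_sig H = (fun _ => True) by apply: set_ext => x; split => // _; apply: h => H' [].
  by have := rk_hyp H; rewrite E (rk_top _ _ _ prj); lia.
rewrite inter_cons => h.
set I := inter Hs in IH h *; have HI : subspace Q M I by apply: inter_subspace.
have mono : subset (spl (dual_lines M n) Hs) (spl (dual_lines M n) (H0 :: Hs)).
  by apply: spl_mono => y; right.
have in0 : spl (dual_lines M n) (H0 :: Hs) H0 by apply: spl_in; left.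
case: (classic (H = H0)) => [->//|ne].
case: (classic (up I H)) => [/IH /mono //|nI].
have nI0 : ~ subset I (proj1_sig H0) by move=> s; apply: nI => x Ix; apply: h; split => //; apply: s.
pose W := meet (proj1_sig H) (proj1_sig H0).
have HW : subspace Q M W by apply: meet_subspace; apply: hyp_subspace.
have E : meet W I = meet (proj1_sig H0) I.
  apply: set_ext => x; split; first by case=> [[_ ?] ?].
  by move=> hx; have := h x hx; case: hx.
have HJ := join_subspace _ M W I.
have rJ : rk M (join M W I) = n.
  have := rk_modular _ _ _ prj _ _ HW HI; rewrite E rk_meet_hyps //.
  have := rk_meet_hyp H0 I HI nI0; lia.
have sd : sdim Q M (join M W I) n by rewrite -rJ; apply: (rk_sdim _ _ _ prj).
pose H' : hyp := exist (fun H => sdim Q M H n) _ sd.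
have H'I : spl (dual_lines M n) (H0 :: Hs) H' by apply: mono; apply: IH; apply: join_r.
have ne' : H' <> H0 by move=> e; apply: nI0; rewrite -e; apply: join_r.
apply: (spl_subspace _ _ (H0 :: Hs) H' H0 (up W) ne' H'I in0).
- by exists W; split => //; apply: meet_sdim.
- exact: join_l.
- by move=> x [].
- by move=> x [].
Qed.

(** Induction on the corank: a point [p] is added to [W], and a hyperplane through [W] avoiding [p]
    cuts the enlarged subspace back to [W]. *)
Lemma subspace_inter W : subspace Q M W -> exists Hs, length Hs + rk M W = n + 1 /\ inter Hs = W.
Proof.
have [d] : exists d, d = n + 1 - rk M W by eexists.
elim: d W => [|d IH] W Hd HW.
  exists []; have := rk_max _ _ _ prj _ HW => rW; split; first by rewrite /=; lia.
  symmetry; apply: (rk_sub_eq _ _ _ prj) => //; first exact: inter_subspace.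
    by move=> x _ H [].
  by have := rk_max _ _ _ prj _ (inter_subspace []); lia.
have [p nWp] : exists p, ~ W p.
  apply: NNPP => nex; have E : W = (fun _ => True).
    by apply: set_ext => x; split => // _; apply: NNPP => h; apply: nex; exists x.
  by move: Hd; rewrite E (rk_top _ _ _ prj); lia.
case: (hyp_exists W p HW nWp) => H [WH nH].
case: (subspace_basis _ _ _ prj _ HW) => xs [ind E]; subst W.
have ind' : indl M (p :: xs) by split.
case: (IH (spl M (p :: xs))) => [||Hs [hl hE]]; last 1 first.
- exists (H :: Hs); rewrite inter_cons hE; move: hl.
  rewrite !(rk_indl _ _ _ prj) //= => hl; split; first by lia.
  have sub : subset (spl M xs) (spl M (p :: xs)) by apply: spl_mono => y; right.
  symmetry; apply: (rk_sub_eq _ _ _ prj) => //.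
  + by apply: meet_subspace; [exact: hyp_subspace | exact: spl_subspace].
  + by move=> x hx; split; [apply: WH | apply: sub].
  + have := rk_meet_hyp H (spl M (p :: xs)) (spl_subspace _ _ _).
    rewrite !(rk_indl _ _ _ prj) //= => h.
    suff /h : ~ subset (spl M (p :: xs)) (proj1_sig H) by lia.
    by move=> s; apply: nH; apply: s; apply: spl_in; left.
- by move: Hd; rewrite !(rk_indl _ _ _ prj) //=; lia.
- exact: spl_subspace.
Qed.

Lemma dual_projective : projective_space hyp (dual_lines M n) n.
Proof.
split; first exact: dual_linear.
split.
  have He := spl_subspace _ M [].
  have r0 : rk M (spl M []) = 0 by rewrite (rk_indl _ _ _ prj).
  have upT : up (spl M []) = (fun _ => True).
    by apply: set_ext => H; split => // _ x h; case: (spl_nil _ _ _ h).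
  split; first by [].
  split.
    case: (subspace_inter _ He) => Hs [hl hE]; exists Hs; split; first by lia.
    by have := dual_spl Hs; rewrite hE upT.
  move=> Hs hl E; have : up (inter Hs) = up (spl M []).
    by rewrite upT -dual_spl; exact: E.
  move/(up_inj _ _ (inter_subspace Hs) He) => E'.
  by have := rk_inter Hs; rewrite E' r0; lia.
move=> S [_ [[Hs [hl E]] _]].
have ES : S = up (inter Hs) by rewrite -dual_spl -E.
have HI := inter_subspace Hs.
have line_sup U : sdim Q M U (n - 1) -> subset (up U) S -> subset (inter Hs) U.
  by move=> [HU _]; rewrite ES; apply: up_sub.
split.
  (* [U1] and [U2] contain an intersection of three hyperplanes, which has rank at least [n - 2]; by
     modularity their join has rank at most [n], so some hyperplane contains both. *)
  move=> l1 l2 [U1 [s1 ->]] [U2 [s2 ->]] h1 h2.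
  have I1 := line_sup _ s1 h1; have I2 := line_sup _ s2 h2.
  have [HU1 _] := s1; have [HU2 _] := s2.
  have HM := meet_subspace _ _ _ _ HU1 HU2.
  have := rk_modular _ _ _ prj _ _ HU1 HU2.
  rewrite (rk_eq _ _ _ _ s1) (rk_eq _ _ _ _ s2) => Hm.
  have := rk_le _ _ _ prj _ _ HI HM (fun x hx => conj (I1 x hx) (I2 x hx)).
  have := rk_inter Hs => h3 h4.
  have [p np] : exists p, ~ join M U1 U2 p.
    apply: NNPP => nex; have Et : join M U1 U2 = (fun _ => True).
      by apply: set_ext => x; split => // _; apply: NNPP => h; apply: nex; exists x.
    by move: Hm; rewrite Et (rk_top _ _ _ prj); lia.
  case: (hyp_exists _ p (join_subspace _ _ _ _) np) => H [JH _].
  by exists H; split => x hx; apply: JH; [apply: join_l | apply: join_r].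
move=> l [U [sU ->]] _; case: (hyp_three U sU) => H1 [H2 [H3 h]]; exists H1, H2, H3; exact: h.
Qed.

End Dual.

End LinearGeometry.

Module BaseSubsets.
Import all_boot zify perm boolp.
Import Pilot.Defs LinearGeometry.
Set Implicit Arguments.
Unset Strict Implicit.
Unset Printing Implicit Defensive.

(** * Permutations of m-subsets preserving separation *)

Lemma exists_between (N m : nat) (X Y : {set 'I_N}) : [disjoint X & Y] -> #|X| <= m -> #|Y| + m <= N ->
  exists A : {set 'I_N}, [/\ #|A| = m, X \subset A & [disjoint A & Y]].
Proof.
move=> XY Xm Ym; set B := ~: (X :|: Y).
have cB : #|X| + #|Y| + #|B| = N.
  by rewrite -cardsUI (disjoint_setI0 XY) cards0 addn0 cardsC card_ord.
set Z := [set i in take (m - #|X|) (enum B)].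
have cZ : #|Z| = m - #|X|.
  rewrite cardsE; have /card_uniqP -> : uniq (take (m - #|X|) (enum B)).
    by rewrite take_uniq // enum_uniq.
  by rewrite size_take -cardE; case: ltnP => //; lia.
have ZB i : i \in Z -> i \in B.
  by rewrite inE => /mem_take; rewrite mem_enum.
exists (X :|: Z); split.
- rewrite cardsU disjoint_setI0 ?cards0 ?cZ; first by lia.
  by rewrite disjoint_sym disjoint_subset; apply/subsetP => i /ZB; rewrite !inE negb_or => /andP[].
- exact: subsetUl.
- rewrite disjoint_subset; apply/subsetP => i; rewrite in_setU => /orP[iX|/ZB].
    by move: (disjointFr XY iX); rewrite inE => ->.
  by rewrite !inE negb_or => /andP[].
Qed.

Section Combinatorics.
Variables (N m : nat).
Hypotheses (m2 : 2 <= m) (mN : m + 2 <= N).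
Implicit Types (A : {set 'I_N}).

Definition sep (p : 'I_N * 'I_N) A := (p.1 \in A) && (p.2 \notin A).

Definition offdiag (p : 'I_N * 'I_N) := p.1 != p.2.

Definition flip (p : 'I_N * 'I_N) := (p.2, p.1).

Lemma exists_sep (p q : 'I_N * 'I_N) : offdiag p -> offdiag q ->
  p.1 != q.2 -> p.2 != q.1 -> exists A : {set 'I_N}, [/\ #|A| = m, sep p A & sep q A].
Proof.
rewrite /offdiag => h1 h2 h3 h4.
case: (@exists_between N m [set p.1; q.1] [set p.2; q.2]) => [|||A [cA /subsetP XA dA]].
- rewrite disjoint_subset; apply/subsetP => i; rewrite !inE => /orP[] /eqP ->;
  by rewrite negb_or ?h1 ?h2 ?h3 // eq_sym h4.
- by rewrite cards2; case: (_ != _); lia.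
- by rewrite cards2; case: (_ != _); lia.
exists A; split => //; apply/andP; split;
  by [apply: XA; rewrite !inE eqxx ?orbT | rewrite (disjointFl dA) // !inE eqxx ?orbT].
Qed.

Variable phi : {set 'I_N} -> {set 'I_N}.
Hypothesis phi_card : forall A, #|A| = m -> #|phi A| = m.
Hypothesis phi_inj : forall A A', #|A| = m -> #|A'| = m -> phi A = phi A' -> A = A'.
Hypothesis phi_sep : forall p, offdiag p -> exists2 q, offdiag q &
  forall A, #|A| = m -> sep q (phi A) -> sep p A.

Let D := [set A : {set 'I_N} | #|A| == m].

Let inD A : (A \in D) = (#|A| == m). Proof. by rewrite inE. Qed.

Let phiD : phi @: D = D.
Proof.
apply/eqP; rewrite eqEcard; apply/andP; split.
  by apply/subsetP => B /imsetP[A]; rewrite !inD => /eqP h ->; rewrite phi_card.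
rewrite card_in_imset // => A A'; rewrite !inD => /eqP h /eqP h'; exact: phi_inj.
Qed.

Lemma phi_onto A : #|A| = m -> exists2 A' : {set 'I_N}, #|A'| = m & phi A' = A.
Proof.
move=> h; have : A \in D by rewrite inD h.
by rewrite -phiD => /imsetP[A']; rewrite inD => /eqP h' ->; exists A'.
Qed.

(** A permutation of the indices carrying [p] to [q] carries one family into the other. *)
Lemma card_sep (p q : 'I_N * 'I_N) : offdiag p -> offdiag q ->
  #|[set A in D | sep p A]| <= #|[set A in D | sep q A]|.
Proof.
rewrite /offdiag => hp hq.
have [s s1 s2] : exists2 s : {perm 'I_N}, s p.1 = q.1 & s p.2 = q.2.
  exists (tperm p.1 q.1 * tperm (tperm p.1 q.1 p.2) q.2)%g; rewrite permM; last by rewrite tpermL.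
  rewrite [tperm p.1 _ p.1]tpermL [LHS]tpermD //; last by rewrite eq_sym.
  apply: contra hp => /eqP e; apply/eqP; apply: (@perm_inj _ (tperm p.1 q.1)).
  by rewrite e tpermL.
rewrite -(card_in_imset (f := fun A : {set 'I_N} => s @: A)); last first.
  move=> A A' _ _; exact: (imset_inj (@perm_inj _ s)).
apply: subset_leq_card; apply/subsetP => B /imsetP[A]; rewrite !inE => /andP[cA /andP[pA1 pA2]] ->.
rewrite card_imset; last exact: perm_inj.
rewrite cA /= /sep -s1 -s2 !mem_imset ?pA1 //; exact: perm_inj.
Qed.

(** The implication includes one separated family in another of the same size, [phi] being a
    bijection of the [m]-sets; so it is an equivalence. *)
Lemma phi_sep_iff p : offdiag p -> exists2 q, offdiag q &
  forall A, #|A| = m -> sep q (phi A) = sep p A.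
Proof.
move=> hp; have [q hq H] := phi_sep hp; exists q => //.
set X := [set A in D | sep q (phi A)].
set Y := [set A in D | sep p A].
suff /setP XY : X = Y by move=> A cA; have := XY A; rewrite !inE cA eqxx.
apply/eqP; rewrite eqEcard; apply/andP; split.
  by apply/subsetP => B; rewrite !inE => /andP[cB h]; rewrite cB /=; apply: H => //; apply/eqP.
apply: leq_trans (card_sep hp hq) _.
have -> : [set A in D | sep q A] = phi @: X.
  apply/setP => B; apply/idP/imsetP.
    rewrite !inE => /andP[/eqP cB h]; case: (phi_onto cB) => B' cB' E.
    by exists B' => //; rewrite !inE cB' eqxx E.
  by case=> B'; rewrite !inE => /andP[/eqP cB' h] ->; rewrite phi_card ?eqxx.
exact: leq_imset_card.
Qed.

(** The index permutation is recovered from the permutation [sg] of ordered pairs. *)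
Lemma exists_perm_or_compl : exists s : {perm 'I_N},
  (forall A, #|A| = m -> phi A = s @: A) \/
  (N = 2 * m /\ forall A, #|A| = m -> phi A = ~: (s @: A)).
Proof.
have /choice[sg Hsg] (p : 'I_N * 'I_N) : exists q, offdiag p ->
    offdiag q /\ forall A, #|A| = m -> sep q (phi A) = sep p A.
  case: (boolP (offdiag p)) => [/phi_sep_iff[q h1 h2]|_]; [by exists q | by exists p].
have sg_off p : offdiag p -> offdiag (sg p) by case/Hsg.
have sgE p (A : {set 'I_N}) : offdiag p -> #|A| = m -> sep (sg p) (phi A) = sep p A by move=> /Hsg[_]; apply.
(* For distinct p, q this says that the families separated by p and by q are disjoint. *)
pose d (p q : 'I_N * 'I_N) := (p.1 == q.2) || (p.2 == q.1).
have dP p q : offdiag p -> offdiag q -> d p q = ~~ [exists A : {set 'I_N}, [&& #|A| == m, sep p A & sep q A]].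
  move=> hp hq; apply/idP/idP.
    move=> h; apply/negP => /existsP[A /and3P[_ /andP[a1 a2] /andP[b1 b2]]].
    by case/orP: h => /eqP e; [rewrite -e a1 in b2 | rewrite e b1 in a2].
  apply: contraR; rewrite negb_or => /andP[h1 h2]; apply/existsP.
  by case: (exists_sep hp hq h1 h2) => A [cA pA qA]; exists A; rewrite cA eqxx pA.
have dsg p q : offdiag p -> offdiag q -> d (sg p) (sg q) = d p q.
  move=> hp hq; rewrite !dP ?sg_off //; congr (~~ _); apply/existsP/existsP => -[A /and3P[/eqP cA]].
    case: (phi_onto cA) => A' cA' <-; rewrite !sgE // => h1 h2.
    by exists A'; rewrite cA' eqxx h1.
  by move=> h1 h2; exists (phi A); rewrite phi_card // eqxx !sgE // h1.
have sg_inj p q : offdiag p -> offdiag q -> sg p = sg q -> p = q.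
  move=> hp hq e.
  have E (A : {set 'I_N}) : #|A| = m -> sep p A = sep q A by move=> cA; rewrite -(sgE p) // -(sgE q) // e.
  have e1 : p.1 = q.1.
    apply/eqP/negP => /negP ne.
    case: (@exists_sep p (p.1, q.1)) => //=; first by rewrite eq_sym.
    move=> A [cA h]; rewrite /sep /= => /andP[_ h']; move: h; rewrite (E _ cA) /sep.
    by rewrite (negbTE h').
  rewrite [p]surjective_pairing [q]surjective_pairing -e1; congr (_, _).
  apply/eqP/negP => /negP ne.
  case: (@exists_sep p (q.2, p.2)) => //=; first by rewrite /offdiag /= eq_sym.
  move=> A [cA h]; rewrite /sep /= => /andP[h' _]; move: h; rewrite (E _ cA) /sep.
  by rewrite h' andbF.
have sg_onto q : offdiag q -> exists2 p, offdiag p & sg p = q.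
  have : sg @: [set p | offdiag p] = [set p | offdiag p].
    apply/eqP; rewrite eqEcard; apply/andP; split.
      by apply/subsetP => r /imsetP[p]; rewrite !inE => /sg_off h ->.
    by rewrite card_in_imset // => p q'; rewrite !inE; apply: sg_inj.
  move/setP/(_ q); rewrite [RHS]inE => h hq; move: h; rewrite hq => /imsetP[p].
  by rewrite inE => hp ->; exists p.
have rev_off p : offdiag p -> offdiag (flip p) by rewrite /offdiag eq_sym.
(* The reversal of [p] is the only pair disjoint from [p] such that no pair is disjoint from
   both. *)
have sg_rev p : offdiag p -> sg (flip p) = flip (sg p).
  move=> hp; have hr := rev_off _ hp.
  have : d (sg p) (sg (flip p)) by rewrite dsg // /d eqxx.
  have nc q : offdiag q -> d q (sg p) -> d q (sg (flip p)) -> False.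
    move=> /sg_onto[z hz <-]; rewrite !dsg // /d /flip /=.
    move: hp hz; case: p hr => i j _; case: z => a b; rewrite /offdiag /= => ij ab.
    by case/orP => /eqP e; case/orP => /eqP e'; subst; rewrite ?eqxx in ij ab.
  have := sg_off _ hp; have := sg_off _ hr; move: nc.
  case: (sg p) => a b; case: (sg (flip p)) => a' b'; rewrite /offdiag /d /flip /= => nc h' h.
  case/orP => /eqP e; subst.
  - case: (eqVneq a' b) => [->//|ne]; case: (nc (b, a')) => //=; rewrite ?eqxx ?orbT //.
    by rewrite eq_sym.
  - case: (eqVneq a b') => [->//|ne]; case: (nc (b', a)) => //=; rewrite ?eqxx ?orbT //.
    by rewrite eq_sym.
(* Testing [p] against the reversal of [q] turns disjointness into agreement in one of the two
   entries. *)
have sim p q : offdiag p -> offdiag q ->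
    ((sg p).1 == (sg q).1) || ((sg p).2 == (sg q).2) = (p.1 == q.1) || (p.2 == q.2).
  by move=> hp hq; have := dsg p (flip q) hp (rev_off _ hq); rewrite sg_rev.
(* Here [m + 2 <= N] leaves room for an [m]-set avoiding [i] and [k], and [2 <= m] gives two
   elements in it. *)
have ex2 (i k : 'I_N) : exists j j', [/\ j != j', j != i, j != k & (j' != i) && (j' != k)].
  case: (@exists_between N m set0 [set i; k]) => [|||A [cA _ dA]].
  - by rewrite disjoints_subset sub0set.
  - by rewrite cards0.
  - by rewrite cards2; case: (_ != _); lia.
  have /card_gt1P[j [j' [jA j'A ne]]] : 1 < #|A| by rewrite cA.
  exists j, j'; have := disjointFr dA jA; have := disjointFr dA j'A.
  by rewrite !inE => /norP[-> ->] /norP[-> ->].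
(* Two distinct images from one row share exactly one coordinate. A third image, agreeing with each
   of them somewhere, must share that same coordinate, so it is constant along the row. *)
have row i : (exists a, forall j, j != i -> (sg (i, j)).1 = a) \/
             (exists a, forall j, j != i -> (sg (i, j)).2 = a).
  have [j [j' [ne ji _ /andP[j'i _]]]] := ex2 i i.
  have off k : k != i -> offdiag (i, k) by rewrite /offdiag /= eq_sym.
  have S k k' : k != i -> k' != i -> ((sg (i, k)).1 == (sg (i, k')).1) || ((sg (i, k)).2 == (sg (i, k')).2).
    by move=> h h'; rewrite sim ?off //= eqxx.
  have neq : sg (i, j) != sg (i, j').
    by apply: contra ne => /eqP /sg_inj; rewrite !off // => /(_ erefl erefl) [->].
  have := S _ _ ji j'i; move: neq S; case E: (sg (i, j)) => [a b]; case E': (sg (i, j')) => [a' b'] /= neq S.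
  case/orP => /eqP e; [left; exists a | right; exists b] => k ki; subst.
  - have := S k j ki ji; have := S k j' ki j'i; rewrite E E' /=.
    case: eqP => [->//|_] /= /eqP -> /eqP e; by rewrite e eqxx in neq.
  - have := S k j ki ji; have := S k j' ki j'i; rewrite E E' /= ![_ || (_ == b')]orbC.
    case: eqP => [->//|_] /= /eqP -> /eqP e; by rewrite e eqxx in neq.
(* Two rows cannot be of different kinds: [(i, j)] and [(k, j)] agree in [j], while the disagreement
   of [(i, j)] with [(k, j')] and of [(i, j')] with [(k, j)] would rule out any agreement of their
   images. *)
have sameT i k a b : (forall j, j != i -> (sg (i, j)).1 = a) ->
    (forall j, j != k -> (sg (k, j)).2 = b) -> i = k.
  move=> hi hk; apply/eqP/negP => /negP ik.
  have [j [j' [ne ji jk /andP[j'i j'k]]]] := ex2 i k.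
  have off x y : y != x -> offdiag (x, y) by rewrite /offdiag /= eq_sym.
  have := sim (i, j) (k, j') (off _ _ ji) (off _ _ j'k).
  have := sim (i, j') (k, j) (off _ _ j'i) (off _ _ jk).
  have := sim (i, j) (k, j) (off _ _ ji) (off _ _ jk).
  rewrite /= !hi // !hk // eqxx orbT (negbTE ik) [j' == j]eq_sym (negbTE ne).
  by case/orP => /eqP ->; rewrite eqxx ?orbT.
(* Both kinds are treated at once: the constant coordinates of distinct rows differ, so they define
   a permutation of the indices. *)
have piP (F : 'I_N * 'I_N -> 'I_N) : (F = fst \/ F = snd) ->
    (forall i, exists a, forall j, j != i -> F (sg (i, j)) = a) ->
    exists s : {perm 'I_N}, forall i j, j != i -> F (sg (i, j)) = s i.
  move=> HF /choice[g Hg].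
  have g_inj : injective g.
    move=> i k e; apply/eqP/negP => /negP ik.
    have [j [j' [ne ji jk /andP[j'i j'k]]]] := ex2 i k.
    have := sim (i, j) (k, j'); rewrite /offdiag /= [i == j]eq_sym ji [k == j']eq_sym j'k.
    move=> /(_ isT isT); rewrite (negbTE ik) (negbTE ne).
    have := Hg i j ji; have := Hg k j' j'k; rewrite -e.
    by case: HF => -> -> ->; rewrite eqxx ?orbT.
  by exists (perm g_inj) => i j ji; rewrite permE; apply: Hg.
have ex_out (A : {set 'I_N}) : #|A| = m -> exists j, j \notin A.
  move=> cA; have : 0 < #|~: A| by have := cardsC A; rewrite card_ord cA; lia.
  by case/card_gt0P => j; rewrite inE; exists j.
have ex_in (A : {set 'I_N}) : #|A| = m -> exists j, j \in A.
  by move=> cA; apply/card_gt0P; rewrite cA; lia.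
have neA (A : {set 'I_N}) i j : i \in A -> j \notin A -> j != i by move=> h; apply: contra => /eqP ->.
have [] : (forall i, exists a, forall j, j != i -> (sg (i, j)).1 = a) \/
          (forall i, exists a, forall j, j != i -> (sg (i, j)).2 = a).
  case: (pselect (exists k b, forall j, j != k -> (sg (k, j)).2 = b)) => [[k [b hk]]|H].
    right=> i; case: (row i) => // -[a hi].
    by exists b; rewrite (sameT _ _ _ _ hi hk).
  by left=> i; case: (row i) => // -[a hi]; case: H; exists i, a.
- case/(piP fst (or_introl erefl)) => s Hs; exists s; left => A cA; apply/esym/eqP.
  rewrite eqEcard phi_card // card_imset ?cA ?leqnn ?andbT; last exact: perm_inj.
  apply/subsetP => x /imsetP[i iA ->]; case: (ex_out _ cA) => j jA.
  have ji := neA _ _ _ iA jA.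
  have := sgE (i, j) A; rewrite /offdiag /= eq_sym ji => /(_ isT cA).
  by rewrite [RHS]/sep /= iA jA => /andP[]; rewrite Hs.
(* Orientation is reversed here, so membership in [A] becomes exclusion from [phi A]. The inclusions
   [H1] and [H2] give [N - m <= m] and [m <= N - m], which forces [N = 2 * m]. *)
- case/(piP snd (or_intror erefl)) => s Hs; exists s; right.
  have H1 (A : {set 'I_N}) : #|A| = m -> s @: (~: A) \subset phi A.
    move=> cA; apply/subsetP => x /imsetP[i]; rewrite inE => iA ->.
    case: (ex_in _ cA) => j jA; have ij := neA _ _ _ jA iA.
    have off : offdiag (j, i) by rewrite /offdiag /= eq_sym.
    have := sgE (j, i) A off cA; rewrite -[(j, i)]/(flip (i, j)) sg_rev //.
      by rewrite [RHS]/sep /= iA jA => /andP[/=]; rewrite Hs // eq_sym.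
  have H2 (A : {set 'I_N}) : #|A| = m -> s @: A \subset ~: phi A.
    move=> cA; apply/subsetP => x /imsetP[i iA ->]; case: (ex_out _ cA) => j jA.
    have ji := neA _ _ _ iA jA.
    have := sgE (i, j) A; rewrite /offdiag /= eq_sym ji => /(_ isT cA).
    by rewrite [RHS]/sep /= iA jA => /andP[_]; rewrite Hs // inE.
  have cs (A : {set 'I_N}) : #|s @: A| = #|A| by apply: card_imset; exact: perm_inj.
  have E : N = 2 * m.
    case: (@exists_between N m set0 set0) => [|||A [cA _ _]].
    - by rewrite disjoints_subset sub0set.
    - by rewrite cards0.
    - by rewrite cards0; lia.
    have := subset_leq_card (H1 _ cA); have := subset_leq_card (H2 _ cA).
    have := cardsC A; have := cardsC (phi A); rewrite !cs phi_card // cA card_ord; lia.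
  split=> // A cA; apply/eqP; rewrite -[X in X == _]setCK (inj_eq (inv_inj (@setCK _))) eq_sym.
  rewrite eqEcard H2 // cs cA.
  have := cardsC (phi A); rewrite phi_card // card_ord; lia.
Qed.

End Combinatorics.

(** * Frames *)

Notation In := List.In.

Lemma In_mem (T : eqType) (s : seq T) x : In x s <-> x \in s.
Proof.
elim: s => //= a s [IH1 IH2]; rewrite in_cons; split.
  by case=> [->|/IH1 ->]; rewrite ?eqxx ?orbT.
by case/orP => [/eqP ->|/IH2]; [left|right].
Qed.

Section Frames.
Variables (P : Type) (L : (P -> Prop) -> Prop) (n : nat).
Hypothesis prj : projective_space P L n.
Implicit Types (A C : {set 'I_n.+1}) (b : 'I_n.+1 -> P).

Definition fspan b A : P -> Prop := span P L (fun x => exists2 i, i \in A & b i = x).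

(** An indexed base: [n + 1] points spanning a space of rank [n + 1] are automatically
    independent. *)
Definition frame b : Prop := fspan b setT = (fun _ => True).

Lemma fspan_subspace b A : subspace P L (fspan b A).
Proof. exact: span_subspace. Qed.
Arguments fspan_subspace : clear implicits.

Lemma fspan_in b A i : i \in A -> fspan b A (b i).
Proof. by move=> iA; apply: span_incl; exists i. Qed.

Lemma fspan_min b A S : subspace P L S -> (forall i, i \in A -> S (b i)) -> subset (fspan b A) S.
Proof. by move=> HS H; apply: span_min => // x [i iA <-]; apply: H. Qed.

Lemma fspan_mono b A C : A \subset C -> subset (fspan b A) (fspan b C).
Proof. by move=> /subsetP AC; apply: span_mono => x [i /AC iC <-]; exists i. Qed.

Lemma fspan_list b A : fspan b A = spl L (map b (enum A)).
Proof.
congr (span _ _ _); apply: set_ext => x; rewrite /list_set; split.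
- by case=> i iA <-; apply: List.in_map; apply/In_mem; rewrite mem_enum.
- by move=> /List.in_map_iff[i [<- /In_mem]]; rewrite mem_enum => iA; exists i.
Qed.

Lemma length_size T (s : seq T) : length s = size s.
Proof. by elim: s => //= a s ->. Qed.

Lemma rk_fspan_le b A : rk L (fspan b A) <= #|A|.
Proof.
by apply/leP; rewrite fspan_list cardE -(size_map b) -length_size; apply: rk_spl_le prj _.
Qed.

(** The ranks of the spans of [A] and of its complement are at most the cardinalities, and by
    modularity their sum is at least [n + 1]; so both bounds are attained. *)
Lemma rk_fspan b A : frame b -> rk L (fspan b A) = #|A|.
Proof.
move=> fb; have := rk_modular _ _ _ prj _ _ (fspan_subspace b A) (fspan_subspace b (~: A)).
have -> : join L (fspan b A) (fspan b (~: A)) = (fun _ => True).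
  apply: set_ext => x; split => // _; have : fspan b setT x by rewrite fb.
  apply: fspan_min; first exact: join_subspace.
  move=> i _; case: (boolP (i \in A)) => iA; first by apply: join_l; apply: fspan_in.
  by apply: join_r; apply: fspan_in; rewrite inE.
rewrite (rk_top _ _ _ prj).
have := rk_fspan_le b A; have := rk_fspan_le b (~: A); have := cardsC A; rewrite card_ord.
lia.
Qed.

Lemma fspan_meet b A C : frame b -> meet (fspan b A) (fspan b C) = fspan b (A :&: C).
Proof.
move=> fb; have HM := meet_subspace _ _ _ _ (fspan_subspace b A) (fspan_subspace b C).
apply: esym; apply: (rk_sub_eq _ _ _ prj) => //; first exact: fspan_subspace.
  by move=> x h; split; move: x h; apply: fspan_mono; rewrite ?subsetIl ?subsetIr.
have := rk_modular _ _ _ prj _ _ (fspan_subspace b A) (fspan_subspace b C).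
have -> : join L (fspan b A) (fspan b C) = fspan b (A :|: C).
  apply: set_ext => x; split.
    by apply: join_min; [exact: fspan_subspace | |]; apply: fspan_mono; rewrite ?subsetUl ?subsetUr.
  apply: fspan_min; first exact: join_subspace.
  by move=> i; rewrite inE => /orP[] iA; [apply: join_l|apply: join_r]; apply: fspan_in.
by rewrite !rk_fspan //; have := cardsUI A C; lia.
Qed.

Lemma fspan0 b x : ~ fspan b set0 x.
Proof. rewrite fspan_list enum_set0; exact: spl_nil. Qed.

(** Index sets whose span contains [x] are closed under intersection by [fspan_meet], so there is a
    smallest one, the support of [x]. *)
Lemma exists_support b x : frame b -> exists E : {set 'I_n.+1}, forall A, fspan b A x <-> E \subset A.
Proof.
move=> fb; pose p (A : {set 'I_n.+1}) := `[< fspan b A x >].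
have pT : p setT by apply/asboolP; rewrite fb.
case: (arg_minnP (fun A : {set 'I_n.+1} => #|A|) pT) => E /asboolP hE Emin.
exists E => A; split => [hA|EA]; last by move: hE; apply: fspan_mono.
have : p (E :&: A) by apply/asboolP; rewrite -fspan_meet.
move/Emin => h; apply/setIidPl/eqP; rewrite eqEcard subsetIl; exact: h.
Qed.

Lemma fspan_frame b A i : frame b -> fspan b A (b i) <-> i \in A.
Proof.
move=> fb; split; last exact: fspan_in.
case: (exists_support (b i) fb) => E HE.
have /HE Ei : fspan b [set i] (b i) by apply: fspan_in; rewrite inE.
move/HE => EA; move: Ei; rewrite subset1 => /orP[/eqP e|/eqP e].
  by move: EA; rewrite e sub1set.
by case: (@fspan0 b (b i)); apply/HE; rewrite e.
Qed.

Lemma frame_inj b : frame b -> injective b.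
Proof.
move=> fb i j e; have : fspan b [set j] (b i) by rewrite e; apply: fspan_in; rewrite inE.
by move/(fspan_frame _ _ fb); rewrite inE => /eqP.
Qed.

Lemma fspan_inj b A C : frame b -> fspan b A = fspan b C -> A = C.
Proof.
move=> fb e; apply/setP => i; apply/idP/idP => /(fspan_in (b := b));
by [rewrite e => /(fspan_frame _ _ fb) | rewrite -e => /(fspan_frame _ _ fb)].
Qed.

Lemma fspan1 b i x : fspan b [set i] x <-> x = b i.
Proof.
rewrite fspan_list enum_set1 /=; split; first exact: spl_single.
by move=> ->; apply: spl_in; left.
Qed.

Lemma list_frame ws : length ws = n.+1 -> spl L ws = (fun _ => True) ->
  exists2 b, frame b & forall x, In x ws <-> exists i, b i = x.
Proof.
case: ws => [//|x0 ws']; set ws := x0 :: ws'; move=> hl top.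
have sz : size ws = n.+1 by rewrite -length_size.
exists (fun i : 'I_n.+1 => nth x0 ws i); last first.
  move=> x; split.
    rewrite -(_ : size ws = n.+1) //; move=> {top hl sz}; elim: ws => //= a s IH.
    case=> [<-|/IH[i <-]]; first by exists ord0.
    by exists (lift ord0 i); rewrite /= /bump.
  case=> i <-; have : nat_of_ord i < size ws by rewrite sz.
  move: (nat_of_ord i) => k; move=> {top hl sz i}; elim: ws k => //= a s IH [|k] h; first by left.
  by right; apply: IH.
apply: set_ext => x; split => // _.
have : spl L ws x by rewrite top.
apply: span_mono => {}x Hx.
suff [i <-] : exists i : 'I_n.+1, nth x0 ws i = x by exists i.
move: Hx; rewrite /list_set -sz; move=> {top hl sz}; elim: ws => //= a s IH.
case=> [<-|/IH[i <-]]; first by exists ord0.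
by exists (lift ord0 i); rewrite /= /bump.
Qed.

Lemma fspan_sublist b ws xs : (forall x, In x ws <-> exists i, b i = x) -> List.incl xs ws ->
  exists A, fspan b A = spl L xs.
Proof.
move=> bw xw; exists [set i | `[< In (b i) xs >]]; congr (span _ _ _); apply: set_ext => x; split.
  by case=> i; rewrite inE => /asboolP h <-.
move=> h; case/bw: (xw _ h) => i e; exists i => //; rewrite inE; apply/asboolP; by rewrite e.
Qed.

Lemma common_frame S U : subspace P L S -> subspace P L U ->
  exists2 b, frame b & exists A C, fspan b A = S /\ fspan b C = U.
Proof.
move=> HS HU; case: (common_basis _ _ _ prj _ _ HS HU) => ws [_ [hl [top [xs [ys [hx [hy [<- <-]]]]]]]].
case: (list_frame hl top) => b fb bw; exists b => //.
case: (fspan_sublist bw hx) => A EA; case: (fspan_sublist bw hy) => C EC.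
by exists A, C.
Qed.

Lemma indl_frame xs : indl L xs -> exists2 b, frame b & forall x, In x xs -> exists i, b i = x.
Proof.
move=> /(indl_extend _ _ _ prj (fun _ => True))[ys [_ [ind top]]].
have E : spl L (ys ++ xs) = fun _ => True by apply: set_ext => x; split => // _; apply: top.
case: (list_frame _ E) => [|b fb bw].
  by rewrite -(rk_indl _ _ _ prj) // E (rk_top _ _ _ prj).
by exists b => // x hx; apply/bw; apply: List.in_or_app; right.
Qed.

Lemma base_frame B : base L B -> exists2 b, frame b & forall x, B x <-> exists i, b i = x.
Proof.
move=> [/(independent_indl _ _ _ prj)[xs [ind ->]] top].
apply: list_frame => //; rewrite -(rk_indl _ _ _ prj) // /spl top (rk_top _ _ _ prj) //.
Qed.

Lemma frame_base b : frame b -> base L (fun x => exists i, b i = x).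
Proof.
move=> fb; have E : fspan b setT = span P L (fun x => exists i, b i = x).
  congr (span _ _ _); apply: set_ext => x; split; first by case=> i _ <-; exists i.
  by case=> i <-; exists i.
split; last by rewrite -E.
move=> Y YX [_ [[i <-] nY]] e.
have : fspan b [set~ i] (b i).
  have : span P L Y (b i) by rewrite e -E fb.
  by apply: span_mono => y Yy; case: (YX _ Yy) => j ej; exists j => //; rewrite !inE;
    apply/eqP => ji; apply: nY; rewrite -ji ej.
by move/(fspan_frame _ _ fb); rewrite !inE eqxx.
Qed.

Lemma fspan_comp b (s : {perm 'I_n.+1}) A : fspan (b \o s) A = fspan b (s @: A).
Proof.
congr (span _ _ _); apply: set_ext => x; split.
  by case=> i iA <-; exists (s i) => //; apply: imset_f.
by case=> _ /imsetP[i iA ->] <-; exists i.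
Qed.

Lemma frame_comp b (s : {perm 'I_n.+1}) : frame b -> frame (b \o s).
Proof.
move=> fb; rewrite /frame fspan_comp -fb; congr fspan; apply/setP => i; rewrite !inE.
by apply/imsetP; exists ((s^-1)%g i); rewrite ?permKV.
Qed.

Lemma card_fspan b A : frame b -> forall S r, fspan b A = S -> rk L S = r -> #|A| = r.
Proof. by move=> fb S r <-; rewrite rk_fspan. Qed.

Lemma dimk_rk S k : dimk P L S k <-> subspace P L S /\ rk L S = k.+1.
Proof.
split; first by move=> h; split; [case: h | exact: rk_eq h].
by case=> HS e; rewrite /dimk -e; apply: rk_sdim prj _ HS.
Qed.

Lemma fspan_dimk b A k : frame b -> #|A| = k.+1 -> dimk P L (fspan b A) k.
Proof. by move=> fb cA; apply/dimk_rk; rewrite rk_fspan //; split=> //; apply: fspan_subspace. Qed.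

Lemma base_subset_fspan b k S : frame b ->
  base_subset P L (fun x => exists i, b i = x) k S <-> exists2 A : {set 'I_n.+1}, #|A| = k.+1 & fspan b A = S.
Proof.
move=> fb; split; last first.
  case=> A cA <-; split; first exact: fspan_dimk.
  exists (fun x => exists2 i, i \in A & b i = x); split => // x [i _ <-]; by exists i.
case=> /dimk_rk[_ rS] [X [Xb E]].
have EA : fspan b [set i | `[< X (b i) >]] = S.
  rewrite -E; congr (span _ _ _); apply: set_ext => x; split.
    by case=> i; rewrite inE => /asboolP h <-.
  by move=> Xx; case: (Xb _ Xx) => i e; exists i => //; rewrite inE; apply/asboolP; rewrite e.
by exists [set i | `[< X (b i) >]] => //; rewrite -(rk_fspan _ fb) EA.
Qed.

End Frames.

(** * The action on base subsets *)

Lemma imsetC_perm (T : finType) (s : {perm T}) (A : {set T}) : ~: (s @: A) = s @: (~: A).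
Proof.
apply/setP => i; rewrite -[i](permKV s) inE !mem_imset ?inE //; exact: perm_inj.
Qed.

Section Transport.
Variables (P Q : Type) (L : (P -> Prop) -> Prop) (M : (Q -> Prop) -> Prop) (n k : nat).
Hypotheses (prjP : projective_space P L n) (prjQ : projective_space Q M n).
Hypotheses (k0 : 0 < k) (kn : k.+1 < n).
Variable f : (P -> Prop) -> (Q -> Prop).
Hypothesis f_base : sends_base_subsets L M k f.
Implicit Types (A : {set 'I_n.+1}) (phi : {set 'I_n.+1} -> {set 'I_n.+1}).

Let k2 : 1 < k.+1. Proof. by []. Qed.

Let kn2 : k.+1 + 2 <= n.+1. Proof. by lia. Qed.

Definition transports (b : 'I_n.+1 -> P) (b' : 'I_n.+1 -> Q) phi : Prop :=
  forall A, #|A| = k.+1 -> #|phi A| = k.+1 /\ f (fspan L b A) = fspan M b' (phi A).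

(** The image of a base subset is a whole base subset of the same finite size, so surjectivity on
    the sets of size [k.+1] gives injectivity. *)
Lemma frame_transports b : frame L b -> exists b' phi, [/\ frame M b', transports b b' phi &
  forall A A', #|A| = k.+1 -> #|A'| = k.+1 -> phi A = phi A' -> A = A'].
Proof.
move=> fb; case: (f_base (frame_base prjP fb)) => B [bB H].
case: (base_frame prjQ bB) => b' fb' /set_ext EB; subst B.
have /choice[phi Hphi] A : exists A', #|A| = k.+1 ->
    #|A'| = k.+1 /\ f (fspan L b A) = fspan M b' A'.
  case: (pselect (#|A| = k.+1)) => [cA|]; last by exists A.
  have /H : exists S, base_subset P L (fun x => exists i, b i = x) k S /\ f S = f (fspan L b A).
    by exists (fspan L b A); split => //; apply/(base_subset_fspan prjP) => //; exists A.
  by case/(base_subset_fspan prjQ) => // A' cA' E; exists A'.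
exists b', phi; split => //.
pose D := [set A : {set 'I_n.+1} | #|A| == k.+1].
suff /imset_injP inj : #|phi @: D| == #|D|.
  by move=> A A' cA cA'; apply: inj; rewrite inE ?cA ?cA'.
rewrite eqn_leq leq_imset_card /=; apply: subset_leq_card; apply/subsetP => A'.
rewrite inE => /eqP cA'.
have /H[S [HS E]] : base_subset Q M (fun x => exists i, b' i = x) k (fspan M b' A').
  by apply/(base_subset_fspan prjQ) => //; exists A'.
case/(base_subset_fspan prjP): HS => // A cA ES.
apply/imsetP; exists A; first by rewrite inE cA.
case: (Hphi A cA) => _; rewrite ES E => e; exact: (fspan_inj prjQ fb' e).
Qed.

Lemma f_inj S U : dimk P L S k -> dimk P L U k -> f S = f U -> S = U.
Proof.
move=> /(dimk_rk prjP)[HS rS] /(dimk_rk prjP)[HU rU].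
case: (common_frame prjP HS HU) => b fb [A [C [EA EC]]].
have cA := card_fspan prjP fb EA rS; have cC := card_fspan prjP fb EC rU.
case: (frame_transports fb) => b' [phi [fb' Hphi inj]].
rewrite -EA -EC; case: (Hphi A cA) => _ ->; case: (Hphi C cC) => _ -> e.
by rewrite (inj A C) //; exact: (fspan_inj prjQ fb' e).
Qed.

(* Moving b_i along the line b_i b_j yields a frame sharing with b exactly the subspaces that are
   spanned by the sets not separated by (i, j).  If every pair of indices were separated by the image
   of one of those sets, then each point of the frame b' would be an intersection of subspaces common
   to the two image base subsets, so these base subsets would coincide. *)
Lemma transports_sep b b' phi : frame L b -> frame M b' -> transports b b' phi ->
  (forall A A', #|A| = k.+1 -> #|A'| = k.+1 -> phi A = phi A' -> A = A') ->
  forall p, offdiag p -> exists2 q, offdiag q &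
    forall A, #|A| = k.+1 -> sep q (phi A) -> sep p A.
Proof.
move=> fb fb' Hphi inj [i j]; rewrite /offdiag /= => ij.
apply: contrapT => nex.
have all_sep i' j' : i' != j' -> exists A : {set 'I_n.+1}, [/\ #|A| = k.+1, ~~ sep (i, j) A & sep (i', j') (phi A)].
  move=> ij'; apply: contrapT => h; apply: nex; exists (i', j') => // A cA sA.
  by apply: contrapT => /negP nA; apply: h; exists A.
have bij : b i <> b j by move=> /(frame_inj prjP fb) e; rewrite e eqxx in ij.
case: (third_point _ _ _ prjP _ _ bij) => c [cl [ci cj]].
pose b2 l := if l == i then c else b l.
have b2i : b2 i = c by rewrite /b2 eqxx.
have b2l l : l != i -> b2 l = b l by rewrite /b2 => /negbTE ->.
have b2j : b2 j = b j by rewrite b2l // eq_sym.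
have b2E A : ~~ sep (i, j) A -> fspan L b2 A = fspan L b A.
  move=> nA; apply: set_ext => x; split; apply: fspan_min => [|l lA]; try exact: fspan_subspace.
  - case: (eqVneq l i) => [e|li]; last by rewrite b2l //; apply: fspan_in.
    subst l; rewrite b2i; move: nA; rewrite /sep /= lA negbK => jA.
    by move: cl; apply: ln_sub; [exact: fspan_subspace | exact: fspan_in | exact: fspan_in].
  - case: (eqVneq l i) => [e|li]; last by rewrite -b2l //; apply: fspan_in.
    subst l; move: nA; rewrite /sep /= lA negbK => jA.
    have := ln_exchange _ _ _ prjP _ _ _ cl cj; rewrite -b2i -b2j; apply: ln_sub.
    + exact: fspan_subspace.
    + exact: fspan_in.
    + exact: fspan_in.
have fb2 : frame L b2.
  by rewrite /frame b2E // /sep !inE andbF.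
case: (frame_transports fb2) => b2' [phi2 [fb2' Hphi2 _]].
have fE A : #|A| = k.+1 -> ~~ sep (i, j) A -> fspan M b' (phi A) = fspan M b2' (phi2 A).
  by move=> cA nA; case: (Hphi A cA) => _ <-; case: (Hphi2 A cA) => _ <-; rewrite b2E.
(* The point [b2' e] is taken in the support of [b' i'] relative to [b2']. Every shared image
   through [b' i'] then contains [b2' e]; since these images separate [i'] from each other index,
   the two points agree. *)
have [e He] : exists e : 'I_n.+1 -> 'I_n.+1, forall l, b2' (e l) = b' l.
  suff /choice[e He] : forall l, exists l', b2' l' = b' l by exists e.
  move=> i'; case: (exists_support prjQ (b' i') fb2') => E HE.
  have [e eE] : exists e, e \in E.
    apply/set0Pn/eqP => E0; case: (@fspan0 _ M _ b2' (b' i')); apply/HE; rewrite E0; exact: sub0set.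
  exists e; case: (exists_support prjQ (b2' e) fb') => E' HE'.
  apply/fspan1/HE'/subsetP => j' j'E; rewrite inE; apply/negPn/negP => ji'.
  have [|A [cA nA /andP[/= s1 s2]]] := all_sep i' j'; first by rewrite eq_sym.
  have : fspan M b' (phi A) (b2' e).
    rewrite fE //; apply: fspan_in; apply: (subsetP _ _ eE); apply/HE.
    by rewrite -fE //; apply: fspan_in.
  by move/HE'/subsetP/(_ _ j'E); rewrite (negbTE s2).
have e_inj : injective e by move=> l l' h; apply: (frame_inj prjQ fb'); rewrite -!He h.
pose s := perm e_inj.
have b's : b' = b2' \o s by apply: funext => l /=; rewrite permE He.
have ji : j != i by rewrite eq_sym.
have offij : offdiag (i, j) by [].
(* Both frames now have the same image base subset, so by injectivity of [f] the span of [A0] under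
   [b2] is the span of some [A1] under [b]. It contains [c], whose support is [{i, j}], so [A1]
   contains [A0] and [j], one element too many. *)
have [A0 [cA0 sA0 _]] := exists_sep k2 kn2 offij offij ij ji.
have [|A1 cA1 E1] := phi_onto (fun A cA => proj1 (Hphi A cA)) inj (A := (s^-1)%g @: phi2 A0).
  by rewrite card_imset; [case: (Hphi2 A0 cA0) | exact: perm_inj].
have E : fspan L b2 A0 = fspan L b A1.
  apply: f_inj; try exact: fspan_dimk.
  case: (Hphi2 A0 cA0) => _ ->; case: (Hphi A1 cA1) => _ ->; rewrite E1 b's fspan_comp.
  congr fspan; rewrite -imset_comp -[LHS]imset_id; apply: eq_imset => l /=; by rewrite permKV.
case/andP: sA0 => /= iA0 jA0.
have sub : A0 :\ i \subset A1.
  apply/subsetP => l; rewrite !inE => /andP[li lA0]; apply/(fspan_frame prjP A1 l fb).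
  by rewrite -E -b2l //; apply: fspan_in.
have [E' HE'] := exists_support prjP c fb.
have cA1' : fspan L b A1 c by rewrite -E -b2i; apply: fspan_in.
have E'ij : E' \subset [set i; j].
  apply/HE'; move: cl; apply: ln_sub; first exact: fspan_subspace.
  - by apply: fspan_in; rewrite !inE eqxx.
  - by apply: fspan_in; rewrite !inE eqxx orbT.
have iE' : i \in E'.
  apply/negPn/negP => h; apply: cj; apply/fspan1/HE'/subsetP => l lE.
  by have := subsetP E'ij l lE; rewrite !inE => /orP[/eqP e'|//]; subst l; rewrite lE in h.
have jE' : j \in E'.
  apply/negPn/negP => h; apply: ci; apply/fspan1/HE'/subsetP => l lE.
  by have := subsetP E'ij l lE; rewrite !inE => /orP[//|/eqP e']; subst l; rewrite lE in h.
move/HE': cA1' => /subsetP sE'.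
have : j |: A0 \subset A1.
  apply/subsetP => l; rewrite !inE => /orP[/eqP ->|lA0]; first exact: sE'.
  case: (eqVneq l i) => [->|li]; first exact: sE'.
  by apply: (subsetP sub); rewrite !inE li.
by move/subset_leq_card; rewrite cardsU1 jA0 cA0 cA1; lia.
Qed.

Lemma frame_type b : frame L b -> exists2 b', frame M b' &
  (forall A, #|A| = k.+1 -> f (fspan L b A) = fspan M b' A) \/
  (n.+1 = 2 * k.+1 /\ forall A, #|A| = k.+1 -> f (fspan L b A) = fspan M b' (~: A)).
Proof.
move=> fb; case: (frame_transports fb) => b' [phi [fb' Hphi inj]].
have [s] := exists_perm_or_compl k2 kn2 (fun A cA => proj1 (Hphi A cA)) inj (transports_sep fb fb' Hphi inj).
have fbs := frame_comp s fb'.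
case=> [H|[e H]]; exists (b' \o s) => //; [left | right; split => //] => A cA.
- by case: (Hphi A cA) => _ ->; rewrite H // fspan_comp.
- by case: (Hphi A cA) => _ ->; rewrite H // fspan_comp imsetC_perm.
Qed.

End Transport.

(** * Descent to points *)

Section Star.
Variables (Q : Type) (M : (Q -> Prop) -> Prop) (n : nat).
Hypothesis prjQ : projective_space Q M n.

(** Otherwise the join [J] of [S] with the span of [C] has rank at least [#|C| + 2], while for each
    [i] outside [C] the join of [S] with the span of [i |: C] has at most that rank. The two joins
    coincide, so [J] contains the whole frame, although the space has rank at least [#|C| + 3]. *)
Lemma star_member (b : 'I_n.+1 -> Q) (C : {set 'I_n.+1}) S : frame M b -> #|C| + 3 <= n.+1 ->
  subspace Q M S -> rk M S = #|C|.+1 ->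
  (forall i, i \notin C -> #|C| <= rk M (meet S (fspan M b (i |: C)))) ->
  subset (fspan M b C) S.
Proof.
move=> fb cC HS rS adj; apply: contrapT => nsub.
have HC := @fspan_subspace _ M _ b C.
pose J := join M S (fspan M b C).
have HJ : subspace Q M J by apply: join_subspace.
have SJ : subset S J by apply: join_l.
have rJ : #|C|.+2 <= rk M J.
  rewrite ltnNge; apply/negP => h; apply: nsub.
  rewrite (rk_sub_eq _ _ _ prjQ S J) //; first exact: join_r.
  by rewrite rS; apply/leP.
have big i : i \notin C -> J (b i) /\ rk M J <= #|C|.+2.
  move=> iC; have HU := @fspan_subspace _ M _ b (i |: C).
  have JU : subset J (join M S (fspan M b (i |: C))).
    apply: join_min; [exact: join_subspace | exact: join_l | ].
    move=> x h; apply: join_r; move: x h; apply: fspan_mono; exact: subsetUr.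
  have := rk_modular _ _ _ prjQ _ _ HS HU; rewrite rS rk_fspan // cardsU1 iC.
  have := adj i iC => h1 h2.
  have h3 : rk M (join M S (fspan M b (i |: C))) <= #|C|.+2 by lia.
  have h4 := rk_le _ _ _ prjQ _ _ HJ (join_subspace _ _ _ _) JU.
  split; last by lia.
  rewrite (rk_sub_eq _ _ _ prjQ J _ HJ (join_subspace _ _ _ _) JU); last by lia.
  by apply: join_r; apply: fspan_in; rewrite !inE eqxx.
have [i0 i0C] : exists i, i \notin C.
  have : 0 < #|~: C| by have := cardsC C; rewrite card_ord; lia.
  by case/card_gt0P => i; rewrite inE; exists i.
have [_ rJ'] := big i0 i0C.
have : rk M J = n.+1.
  rewrite -(rk_top _ _ _ prjQ); congr (rk M _); apply: set_ext => x; split => // _.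
  have : fspan M b setT x by rewrite fb.
  apply: fspan_min => // i _; case: (boolP (i \in C)) => iC; last by case: (big i iC).
  by apply: join_r; apply: fspan_in.
lia.
Qed.

(** An index [j] in the support of [y] but not in [X] would be avoided by some [m]-set containing
    [X]. *)
Lemma fspan_inter (b : 'I_n.+1 -> Q) (X : {set 'I_n.+1}) m y : frame M b -> #|X| <= m -> m < n.+1 ->
  (forall A : {set 'I_n.+1}, #|A| = m -> X \subset A -> fspan M b A y) -> fspan M b X y.
Proof.
move=> fb cX mn H; case: (exists_support prjQ y fb) => E HE; apply/HE/subsetP => j jE.
apply/negPn/negP => jX.
case: (@exists_between n.+1 m X [set j]) => // [||A [cA XA dA]].
- by rewrite disjoint_sym disjoints1.
- by rewrite cards1; lia.
have /HE/subsetP/(_ _ jE) := H A cA XA.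
by rewrite (disjointFl dA) // inE.
Qed.

End Star.

(** * Direct and dual type of a map of subspaces *)

Section Types.
Variables (P Q : Type) (L : (P -> Prop) -> Prop) (M : (Q -> Prop) -> Prop) (n : nat).
Hypotheses (prjP : projective_space P L n) (prjQ : projective_space Q M n).
Implicit Types (A C : {set 'I_n.+1}) (f : (P -> Prop) -> (Q -> Prop)).

Definition direct_on f m (b : 'I_n.+1 -> P) (b' : 'I_n.+1 -> Q) : Prop :=
  forall A, #|A| = m -> f (fspan L b A) = fspan M b' A.

Definition dual_on f m (b : 'I_n.+1 -> P) (b' : 'I_n.+1 -> Q) : Prop :=
  n.+1 = 2 * m /\ forall A, #|A| = m -> f (fspan L b A) = fspan M b' (~: A).

Definition adj_preserving f m : Prop := forall S U,
  subspace P L S -> subspace P L U -> rk L S = m -> rk L U = m ->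
  [/\ subspace Q M (f S), rk M (f S) = m & rk M (meet (f S) (f U)) = rk L (meet S U)].

Lemma frame_adj f m :
  (forall b, frame L b -> exists2 b', frame M b' & direct_on f m b b' \/ dual_on f m b b') ->
  adj_preserving f m.
Proof.
move=> H S U HS HU rS rU; case: (common_frame prjP HS HU) => b fb [A [C [EA EC]]].
have cA := card_fspan prjP fb EA rS; have cC := card_fspan prjP fb EC rU.
case: (H b fb) => b' fb'.
have Lmeet : rk L (meet S U) = #|A :&: C| by rewrite -EA -EC fspan_meet // rk_fspan.
case=> [D|[e D]]; rewrite Lmeet -EA -EC !D // !fspan_meet // !rk_fspan //; split => //.
- exact: fspan_subspace.
- exact: fspan_subspace.
- by have := cardsC A; rewrite card_ord cA; lia.
(* Complementation keeps the size of intersections because the sets have half the size of the index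
   set. *)
- rewrite -setCU; have := cardsC (A :|: C); have := cardsUI A C; rewrite card_ord; lia.
Qed.

(** Since ranks of intersections are kept, [star_member] reaches every [S] through the span of [C],
    not only those spanned by points of the frame [b]. *)
Lemma star_image f r b b' C S : adj_preserving f r.+1 -> frame L b -> frame M b' ->
  direct_on f r.+1 b b' -> #|C| = r -> r + 3 <= n.+1 ->
  subspace P L S -> rk L S = r.+1 -> subset (fspan L b C) S -> subset (fspan M b' C) (f S).
Proof.
move=> adj fb fb' D cC rn HS rS CS.
case: (adj S S) => // HfS rfS _.
apply: (star_member prjQ fb') => // [||i iC]; rewrite ?cC //.
have ciC : #|i |: C| = r.+1 by rewrite cardsU1 iC cC.
have HU := @fspan_subspace _ L _ b (i |: C).
case: (adj S (fspan L b (i |: C))) => //; first by rewrite rk_fspan.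
rewrite D // => _ _ ->; rewrite -cC -(rk_fspan prjP C fb).
apply/leP/(rk_le _ _ _ prjP); [exact: fspan_subspace | exact: meet_subspace |].
move=> x h; split; first exact: CS.
by move: x h; apply: fspan_mono; exact: subsetUr.
Qed.

(** Along the star of the common subspace, the direct frame forces all images through [b' i] for [i]
    in [A], which is nonempty as [0 < r]; by the dual frame, the images of the spans of the sets
    [j |: C] have no common point. *)
Lemma direct_dual_exclusive f r b b' c c' A C : adj_preserving f r.+1 ->
  frame L b -> frame M b' -> frame L c -> frame M c' -> 0 < r -> r + 3 <= n.+1 ->
  direct_on f r.+1 b b' -> dual_on f r.+1 c c' -> #|A| = r -> #|C| = r ->
  fspan L b A = fspan L c C -> False.
Proof.
move=> adj fb fb' fc fc' r0 rn D [_ DD] cA cC E.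
have [i iA] : exists i, i \in A by apply/card_gt0P; rewrite cA.
case: (exists_support prjQ (b' i) fc') => E' HE.
suff E0 : E' = set0 by apply: (@fspan0 _ M _ c' (b' i)); apply/HE; rewrite E0.
have [j0 j0C] : exists j, j \notin C.
  have : 0 < #|~: C| by have := cardsC C; rewrite card_ord; lia.
  by case/card_gt0P => j; rewrite inE; exists j.
have sub j : j \notin C -> E' \subset ~: (j |: C).
  move=> jC; have cj : #|j |: C| = r.+1 by rewrite cardsU1 jC cC.
  apply/HE; rewrite -DD //.
  apply: (star_image adj fb fb' D cA) => //; first exact: fspan_subspace.
  - by rewrite rk_fspan.
  - by rewrite E; apply: fspan_mono; exact: subsetUr.
  - exact: fspan_in.
apply/setP => j; rewrite [RHS]inE; apply/negP => jE.
case: (boolP (j \in C)) => jC.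
- by have /subsetP/(_ _ jE) := sub _ j0C; rewrite !inE jC orbT.
- by have /subsetP/(_ _ jE) := sub _ jC; rewrite !inE eqxx.
Qed.

(** Given a dual frame [b] and a direct frame [c], a third frame [d] is chosen to span both a
    rank-[r] subspace spanned by part of [b] and one spanned by part of [c]. Whatever its type, [d]
    clashes with one of them. *)
Lemma direct_or_dual f r : 0 < r -> r + 3 <= n.+1 ->
  (forall b, frame L b -> exists2 b', frame M b' & direct_on f r.+1 b b' \/ dual_on f r.+1 b b') ->
  (forall b, frame L b -> exists2 b', frame M b' & direct_on f r.+1 b b') \/
  (forall b, frame L b -> exists2 b', frame M b' & dual_on f r.+1 b b').
Proof.
move=> r0 rn H; have adj := frame_adj H; apply: contrapT => /not_orP[].
move=> /existsNP[b /not_implyP[fb nD]] /existsNP[c /not_implyP[fc nDD]].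
case: (H b fb) => b' fb' [D|DD]; first by case: nD; exists b'.
case: (H c fc) => c' fc' [D|DD']; last by case: nDD; exists c'.
case: (@exists_between n.+1 r set0 set0) => [|||X [cX _ _]].
- by rewrite disjoints_subset sub0set.
- by rewrite cards0.
- by rewrite cards0; lia.
have Hb := @fspan_subspace _ L _ b X; have Hc := @fspan_subspace _ L _ c X.
case: (common_frame prjP Hb Hc) => d fd [A [C [EA EC]]].
have cA : #|A| = r by apply: (card_fspan prjP fd EA); rewrite rk_fspan.
have cC : #|C| = r by apply: (card_fspan prjP fd EC); rewrite rk_fspan.
case: (H d fd) => d' fd' [D'|DD'].
- exact: (direct_dual_exclusive adj fd fd' fb fb' r0 rn D' DD cA cX EA).
- exact: (direct_dual_exclusive adj fc fc' fd fd' r0 rn D DD' cX cC (esym EC)).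
Qed.

(* The image of a subspace X is recovered as the intersection of the images of the subspaces of rank
   one more through X; the frame b' is unchanged along this descent. *)
Lemma direct_point_map f m : 0 < m -> m + 2 <= n.+1 ->
  (forall b, frame L b -> exists2 b', frame M b' & direct_on f m b b') ->
  exists g : P -> Q, forall S x, subspace P L S -> rk L S = m -> S x -> f S (g x).
Proof.
elim: m f => // -[|m] IH f _ mn H.
  have /choice[g Hg] x : exists y, f (spl L [:: x]) y.
    have [|b fb Hb] := indl_frame prjP (xs := [:: x]); first by split => //; apply: spl_nil.
    case: (Hb x) => [|i Hi]; first by left.
    case: (H b fb) => b' fb' D.
    have -> : spl L [:: x] = fspan L b [set i] by rewrite fspan_list enum_set1 /= Hi.
    by rewrite D ?cards1 //; exists (b' i); apply: fspan_in; rewrite inE.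
  exists g => S x HS rS Sx.
  have <- : spl L [:: x] = S => //.
  apply: (rk_sub_eq _ _ _ prjP) => //; first exact: spl_subspace.
    by apply: spl_min => // y [<-|[]].
  by rewrite rS (rk_indl _ _ _ prjP) //=; split => //; apply: spl_nil.
pose F (X : P -> Prop) : Q -> Prop :=
  fun q => forall S, subspace P L S -> rk L S = m.+2 -> subset X S -> f S q.
have adj : adj_preserving f m.+2.
  by apply: frame_adj => b /H[b' fb' D]; exists b' => //; left.
case: (IH F) => // [||g Hg]; first by lia.
- move=> b fb; case: (H b fb) => b' fb' D; exists b' => // A cA.
  apply: set_ext => q; split; last first.
    move=> Aq S HS rS AS; apply: (star_image adj fb fb' D cA _ HS rS AS) => //; lia.
  move=> Fq; apply: (fspan_inter prjQ (m := m.+2) fb'); rewrite ?cA //; first by lia.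
  move=> C cC AC; rewrite -D //; apply: Fq; [exact: fspan_subspace | by rewrite rk_fspan |].
  exact: fspan_mono.
- exists g => S x HS rS Sx.
  have [b fb [A [C [EA EC]]]] := common_frame prjP HS (spl_subspace P L [:: x]).
  have cA := card_fspan prjP fb EA rS.
  have ind : indl L [:: x] by split => //; apply: spl_nil.
  have cC := card_fspan prjP fb EC (rk_indl _ _ _ prjP _ ind).
  have CA : C \subset A.
    apply/subsetP => i iC; apply/(fspan_frame prjP A i fb); rewrite EA.
    have : spl L [:: x] (b i) by rewrite -EC; apply: fspan_in.
    by move=> h; rewrite (spl_single _ _ _ _ h).
  (* Removing [b j] with [j] outside the support of [x] leaves a subspace of rank [m.+1] that still
     contains [x], to which the induction hypothesis applies. *)
  have [j] : exists j, j \in A :\: C.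
    by apply/card_gt0P; have := cardsID C A; rewrite (setIidPr CA) cA cC /=; lia.
  rewrite inE => /andP[jC jA].
  apply: (Hg (fspan L b (A :\ j)) x) => //.
  - exact: fspan_subspace.
  - by rewrite rk_fspan //; have := cardsD1 j A; rewrite jA cA => -[].
  - have : spl L [:: x] x by apply: spl_in; left.
    rewrite -EC; apply: fspan_mono; apply/subsetP => i iC; rewrite !inE (subsetP CA) // andbT.
    by apply: contra jC => /eqP <-.
  - by rewrite -EA; apply: fspan_mono; exact: subsetDl.
Qed.

Lemma direct_embedding f m : 1 < m -> m + 2 <= n.+1 ->
  (forall b, frame L b -> exists2 b', frame M b' & direct_on f m b b') ->
  exists g : P -> Q, strong_embedding L M g /\
    forall S, subspace P L S -> rk L S = m -> f S = span Q M (image g S).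
Proof.
move=> m1 mn H; case: (direct_point_map (ltnW m1) mn H) => g Hg.
(* The point [b' i] is the intersection of the images for the [m]-sets containing [i], and [g (b i)]
   lies in all of them; so [b'] is [g \o b]. *)
have gb b : frame L b -> frame M (g \o b) /\ direct_on f m b (g \o b).
  move=> fb; case: (H b fb) => b' fb' D; suff -> : g \o b = b' by [].
  apply: funext => i /=; apply/fspan1; apply: (fspan_inter prjQ (m := m) fb').
  - by rewrite cards1; lia.
  - by lia.
  move=> A cA; rewrite sub1set => iA; rewrite -D //; apply: Hg; first exact: fspan_subspace.
    by rewrite rk_fspan.
  exact: fspan_in.
(* The image line is the intersection of the images for the [m]-sets containing [i] and [j]; here
   [1 < m] is needed. *)
have g_ln p q r : spl L [:: q; r] p -> spl M [:: g q; g r] (g p).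
  move=> Hp; case: (pselect (q = r)) => [E|qr].
    have -> : p = q by apply: (spl_single P L); apply: spl_mono Hp => y; rewrite E /=; tauto.
    by apply: spl_in; left.
  have [|b fb Hb] := indl_frame prjP (xs := [:: q; r]).
    by split; [move=> h; case: qr; exact: (spl_single _ _ _ _ h) | split => //; apply: spl_nil].
  case: (Hb q) => [|i Ei]; first by left.
  case: (Hb r) => [|j Ej]; first by right; left.
  case: (gb b fb) => fgb D.
  suff : fspan M (g \o b) [set i; j] (g p).
    apply: fspan_min; first exact: spl_subspace.
    by move=> l; rewrite !inE => /orP[] /eqP -> /=; rewrite ?Ei ?Ej; apply: spl_in; rewrite /=; auto.
  apply: (fspan_inter prjQ (m := m)) => //; [by rewrite cards2; case: (_ != _); lia | by lia |].
  move=> A cA; rewrite subUset !sub1set => /andP[iA jA]; rewrite -D //.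
  apply: Hg; [exact: fspan_subspace | by rewrite rk_fspan |].
  by move: Hp; apply: ln_sub; rewrite -?Ei -?Ej; first exact: fspan_subspace; apply: fspan_in.
(* An independent list is part of a frame, and [g] sends frames to frames. *)
have g_indl xs : indl L xs -> indl M (List.map g xs).
  move=> ind; case: (indl_frame prjP ind) => b fb; case: (gb b fb) => fgb _.
  elim: xs ind => //= x xs IH [nx ind] Hb; split; last by apply: IH => // y hy; apply: Hb; right.
  case: (Hb x) => [|i Hi]; first by left.
  pose A := [set j | `[< In (b j) xs >]].
  have sub : subset (spl M (List.map g xs)) (fspan M (g \o b) A).
    apply: spl_min; first exact: fspan_subspace.
    move=> _ /List.in_map_iff[y [<- hy]]; case: (Hb y) => [|j Hj]; first by right.
    rewrite -Hj; apply: (@fspan_in _ M _ (g \o b)); rewrite inE; apply/asboolP; by rewrite Hj.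
  move/sub; rewrite -Hi => /(fspan_frame prjQ A i fgb); rewrite inE => /asboolP h.
  by apply: nx; rewrite -Hi; apply: spl_in.
have n1 : (1 <= n)%coq_nat by lia.
exists g; split; last first.
  move=> S HS rS; case: (common_frame prjP HS HS) => b fb [A [_ [EA _]]].
  have cA := card_fspan prjP fb EA rS; case: (gb b fb) => fgb D.
  have EfS : f S = fspan M (g \o b) A by rewrite -EA D.
  apply: set_ext => y; split.
    rewrite EfS; apply: fspan_min; first exact: span_subspace.
    by move=> i iA; apply: span_incl; exists (b i); split => //; rewrite -EA; apply: fspan_in.
  apply: span_min; first by rewrite EfS; apply: fspan_subspace.
  by move=> _ [x [Sx <-]]; apply: Hg.
split.
  move=> x y E; apply: contrapT => xy.
  have /g_indl /= : indl L [:: x; y].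
    by split; [move=> h; case: xy; exact: (spl_single _ _ _ _ h) | split => //; apply: spl_nil].
  by rewrite E => -[h _]; apply: h; apply: spl_in; left.
split.
  move=> p q r /(collinear_indl _ _ _ prjP _ _ _ n1) nind.
  apply/(collinear_indl _ _ _ prjQ _ _ _ n1) => /= -[h1 [h2 _]]; apply: nind; split.
    by move/g_ln.
  split; last by split => //; apply: spl_nil.
  by move=> h; apply: h2; rewrite (spl_single _ _ _ _ h); apply: spl_in; left.
split.
  move=> p q r nc; apply/(collinear_indl _ _ _ prjQ _ _ _ n1) => nind; apply: nind.
  apply: (g_indl [:: p; q; r]); apply: contrapT => nind; apply: nc.
  exact/(collinear_indl _ _ _ prjP _ _ _ n1).
move=> X /(independent_indl _ _ _ prjP)[xs [/g_indl ind ->]].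
have -> : image g (list_set xs) = list_set (List.map g xs).
  by apply: set_ext => y; rewrite /list_set List.in_map_iff; split => -[x [? ?]]; exists x.
exact: (indl_independent _ _ _ prjQ).
Qed.

End Types.

(** * The dual case *)

Section DualFrame.
Variables (Q : Type) (M : (Q -> Prop) -> Prop) (n : nat).
Hypotheses (prjQ : projective_space Q M n) (n2 : (2 <= n)%coq_nat).

(** The hyperplane [h i] is the face opposite [b i]; a point lies in all faces [h i] with [i] in [A]
    exactly when its support avoids [A]. *)
Lemma dual_frame b : frame M b -> exists2 h : 'I_n.+1 -> hyperplane M n, frame (dual_lines M n) h &
  forall A, fspan (dual_lines M n) h A = up _ M n (fspan M b (~: A)).
Proof.
move=> fb; have sd i : sdim Q M (fspan M b [set~ i]) n.
  have rn : rk M (fspan M b [set~ i]) = n by rewrite rk_fspan // cardsC1 card_ord.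
  by have := rk_sdim _ _ _ prjQ _ (@fspan_subspace _ M _ b [set~ i]); rewrite rn.
pose h i : hyperplane M n := exist (fun H => sdim Q M H n) _ (sd i).
have hE A : fspan (dual_lines M n) h A = up _ M n (fspan M b (~: A)).
  rewrite fspan_list (dual_spl _ _ _ prjQ n2); congr (up _ _ _ _).
  apply: set_ext => x; case: (exists_support prjQ x fb) => E HE; split.
    move=> Hx; apply/HE; rewrite -disjoints_subset disjoint_sym disjoint_subset.
    apply/subsetP => i iA; rewrite inE.
    have /HE/subsetP Ei : fspan M b [set~ i] x.
      by apply: (Hx (h i)); apply: List.in_map; apply/In_mem; rewrite mem_enum.
    by apply/negP => /Ei; rewrite !inE eqxx.
  move=> Hx _ /List.in_map_iff[i [<- /In_mem]]; rewrite mem_enum => iA /=.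
  move: Hx; apply: fspan_mono; apply/subsetP => j; rewrite !inE; apply: contra => /eqP -> //.
exists h => //; rewrite /frame hE setCT; apply: set_ext => H; split => // _ x h0.
by case: (fspan0 h0).
Qed.

End DualFrame.

(** * Assembly of the two cases *)

Section Main.
Variables (P Q : Type) (L : (P -> Prop) -> Prop) (M : (Q -> Prop) -> Prop) (n k : nat).
Hypotheses (prjP : projective_space P L n) (prjQ : projective_space Q M n).
Hypotheses (k0 : (0 < k)%coq_nat) (kn : (k < n - 1)%coq_nat).
Variable f : (P -> Prop) -> (Q -> Prop).

Lemma base_subset_embedding : sends_base_subsets L M k f ->
  (exists g : P -> Q, strong_embedding L M g /\
     forall S, dimk P L S k -> f S = span Q M (image g S)) \/
  (n = 2 * k + 1)%coq_nat /\
  (exists g : P -> hyperplane M n, strong_embedding L (dual_lines M n) g /\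
     forall S, dimk P L S k ->
       span _ (dual_lines M n) (image g S) =
       (fun H : hyperplane M n => subset (f S) (proj1_sig H))).
Proof.
move=> fB.
have k0' : 0 < k by lia.
have kn' : k.+1 < n by lia.
have n2 : (2 <= n)%coq_nat by lia.
have k1 : 1 < k.+1 by [].
have kn2 : k.+1 + 2 <= n.+1 by lia.
have kn3 : k + 3 <= n.+1 by lia.
case: (direct_or_dual prjP prjQ k0' kn3 (frame_type prjP prjQ k0' kn' fB)) => H.
  case: (direct_embedding prjP prjQ k1 kn2 H) => g [emb Hg]; left; exists g; split => //.
  by move=> S /(dimk_rk prjP)[HS rS]; apply: Hg.
right; split.
  (* The relation between [n] and [k] is read off any frame; the empty list serves to produce
     one. *)
  case: (indl_frame prjP (xs := [::])) => // b fb _.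
  by case: (H b fb) => b' _ [e _]; lia.
have dprj := dual_projective _ _ _ prjQ n2.
(* The direct case is applied with the dual of the target: [dual_frame] complements index sets once
   more, which cancels the complement in [dual_on]. *)
case: (@direct_embedding _ _ _ _ _ prjP dprj (fun S => up _ M n (f S)) _ k1 kn2).
  move=> b fb; case: (H b fb) => b' fb' [_ D].
  case: (dual_frame prjQ n2 fb') => h fh hE; exists h => // A cA.
  by rewrite hE D.
move=> g [emb Hg]; exists g; split => // S /(dimk_rk prjP)[HS rS].
by rewrite -Hg.
Qed.

End Main.

End BaseSubsets.

Theorem theorem2p2 (P Q : Type) (L : (P -> Prop) -> Prop) (M : (Q -> Prop) -> Prop)
  (n k : nat) (f : (P -> Prop) -> (Q -> Prop)) :
  projective_space P L n -> projective_space Q M n ->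
  0 < k -> k < n - 1 ->
  (forall S, dimk P L S k -> dimk Q M (f S) k) ->
  sends_base_subsets L M k f ->
  (n <> 2 * k + 1 ->
     exists g : P -> Q, strong_embedding L M g /\
       forall S, dimk P L S k -> f S = span Q M (image g S)) /\
  (n = 2 * k + 1 ->
     (exists g : P -> Q, strong_embedding L M g /\
        forall S, dimk P L S k -> f S = span Q M (image g S)) \/
     (exists g : P -> hyperplane M n, strong_embedding L (dual_lines M n) g /\
        forall S, dimk P L S k ->
          span _ (dual_lines M n) (image g S) =
          (fun H : hyperplane M n => subset (f S) (proj1_sig H)))).
Proof.
intros prjP prjQ k0 kn _ fB.
destruct (BaseSubsets.base_subset_embedding prjP prjQ k0 kn fB) as [H | [E H]].
- split; intros _; [exact H | left; exact H].
- split; [intros ne; destruct (ne E) | intros _; right; exact H].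
Qed.
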